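(* Let $f \colon \mathbb{R}^{n} \to \mathbb{R}$ be an $L$-Lipschitz function, $n \geq 1$. Let $1 \leq p < 2n/(n-2)$ if $n \geq 3$, let $1 \leq p < \infty$ if $n = 2$, and let $1 \leq p \leq \infty$ if $n = 1$. Then, for any $C \geq 1$, $$\sum_{Q \in \mathcal{D},\, Q \subset Q_{0}} \beta_{p}(CQ)^{2}\,|Q| \lesssim_{C} L|Q_{0}|, \qquad Q_{0} \in \mathcal{D}.$$
   Context: $X \lesssim_C Y$ means that $X \leq KY$ for a constant $K$ depending on $C$, where dependence on the fixed parameters $n$ and $p$ is suppressed from the notation. $\mathcal{D}$ is the family of standard dyadic cubes in $\mathbb{R}^{n}$; $|Q|=\ell(Q)^n$ is the Lebesgue measure of $Q$, where $\ell(Q)$ is the side-length; $CQ$ is the cube concentric with $Q$ with $\operatorname{diam}(CQ) = C\operatorname{diam}(Q)$. For a bounded set $Q \subset \mathbb{R}^{n}$ and $1 \leq p < \infty$, $$\beta_{p}(Q) := \inf_{A} \left[\frac{1}{\operatorname{diam}(Q)^{n}} \int_{Q} \left(\frac{|f - A|}{\operatorname{diam}(Q)} \right)^{p} d\mathcal{L}^{n} \right]^{1/p},\qquad \beta_{\infty}(Q) := \inf_{A} \sup_{x \in Q} \frac{|f(x) - A(x)|}{\operatorname{diam}(Q)},$$ where the infimum runs over all affine maps $A \colon \mathbb{R}^{n} \to \mathbb{R}$, and $\mathcal{L}^n$ is Lebesgue measure.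
   Formalization: The bound is proved as K L^2|Q_0| in place of the printed L|Q_0|, which fails with a constant depending only on n, p, C: replacing (f, L) by (tf, tL) scales the left side by t^2 but the right side only by t. *)

(* Defs.v *)
From HB Require Import structures.
From mathcomp Require Import all_boot all_order all_algebra.
From mathcomp Require Import all_classical all_reals all_analysis.

Set Implicit Arguments.
Unset Strict Implicit.
Unset Printing Implicit Defensive.

Import Order.TTheory GRing.Theory Num.Theory.
Import numFieldNormedType.Exports.

Local Open Scope classical_set_scope.
Local Open Scope ring_scope.

(* Points of R^n are tuples, which carry the product sigma-algebra; the type
   'rV[R]_n has no measurable structure and its norm is the sup norm. *)
Notation "''E[' R ]_ n" := (n.-tuple (measurableTypeR R))
  (at level 8, n at level 2, format "''E[' R ]_ n") : type_scope.

Section lebesgue_tuple.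
Context {R : realType}.

Definition tuple_cons n (x : measurableTypeR R * 'E[R]_n) : 'E[R]_n.+1 :=
  [tuple of x.1 :: x.2].

Definition tuple_uncons n (x : 'E[R]_n.+1) : measurableTypeR R * 'E[R]_n :=
  (thead x, [tuple of behead x]).

Lemma tuple_consK n : cancel (@tuple_cons n) (@tuple_uncons n).
Proof.
by case=> a t; congr pair; apply: val_inj.
Qed.

Lemma measurable_tuple_cons n : measurable_fun [set: _] (@tuple_cons n).
Proof. by apply: measurable_cons. Qed.

Lemma measurable_tuple_uncons n : measurable_fun [set: _] (@tuple_uncons n).
Proof.
apply/measurable_fun_pairP; split.
  exact: (@measurable_tnth _ (measurableTypeR R) n.+1 ord0).
exact: measurable_behead.
Qed.

Section lebesgue_cons.
Variables (n : nat) (mu : {sigma_finite_measure set 'E[R]_n -> \bar R}).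

Definition lebesgue_cons : set 'E[R]_n.+1 -> \bar R :=
  pushforward (@lebesgue_measure R \x mu)%E (@tuple_cons n).

Let lebesgue_consE (A : set 'E[R]_n.+1) :
  lebesgue_cons A = (@lebesgue_measure R \x mu)%E (@tuple_cons n @^-1` A).
Proof. by []. Qed.

Let measurable_preimage_cons (A : set 'E[R]_n.+1) :
  measurable A -> measurable (@tuple_cons n @^-1` A).
Proof.
by move=> mA; rewrite -[X in measurable X]setTI; exact: measurable_tuple_cons.
Qed.

Let lebesgue_cons0 : lebesgue_cons set0 = 0%E.
Proof. by rewrite lebesgue_consE preimage_set0 measure0. Qed.

Let lebesgue_cons_ge0 A : (0 <= lebesgue_cons A)%E.
Proof. by rewrite lebesgue_consE measure_ge0. Qed.

Let lebesgue_cons_sigma_additive : semi_sigma_additive lebesgue_cons.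
Proof.
move=> F mF tF mUF; rewrite lebesgue_consE preimage_bigcup.
apply: (@measure_semi_sigma_additive _ _ _ (lebesgue_measure \x mu)%E).
- by move=> k; exact: measurable_preimage_cons.
- apply/trivIsetP => i j _ _ ij; rewrite -preimage_setI.
  by move/trivIsetP : tF => /(_ _ _ _ _ ij) -> //; rewrite preimage_set0.
- by rewrite -preimage_bigcup; exact: measurable_preimage_cons.
Qed.

HB.instance Definition _ := isMeasure.Build _ _ _ lebesgue_cons
  lebesgue_cons0 lebesgue_cons_ge0 lebesgue_cons_sigma_additive.

Lemma lebesgue_cons_sigma_finite : sigma_finite [set: 'E[R]_n.+1] lebesgue_cons.
Proof.
have /sigma_finiteP[F [FT ndF Foo]] := sigma_finiteT (@lebesgue_measure R).
have /sigma_finiteP[G [GT ndG Goo]] := sigma_finiteT mu.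
exists (fun k => @tuple_uncons n @^-1` (F k `*` G k)).
  rewrite -preimage_bigcup; apply/seteqP; split => // x _ /=.
  have [i _ Fi] : (\bigcup_i F i) (tuple_uncons x).1 by rewrite -FT.
  have [j _ Gj] : (\bigcup_i G i) (tuple_uncons x).2 by rewrite -GT.
  exists (maxn i j) => //; split.
    by move: Fi; apply/subsetPset/ndF/leq_maxl.
  by move: Gj; apply/subsetPset/ndG/leq_maxr.
move=> k; have [mF Fk] := Foo k; have [mG Gk] := Goo k.
have mFG : measurable (F k `*` G k) by exact: measurableX.
split.
  by rewrite -[X in measurable X]setTI; exact: measurable_tuple_uncons.
rewrite lebesgue_consE -comp_preimage.
rewrite (_ : _ \o _ = id) ?preimage_id; last first.
  by apply/funext => x; exact: tuple_consK.
by rewrite product_measure1E// lte_mul_pinfty// ge0_fin_numE.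
Qed.

HB.instance Definition _ :=
  Measure_isSigmaFinite.Build _ _ _ lebesgue_cons lebesgue_cons_sigma_finite.

End lebesgue_cons.

Definition lebesgue_nil : set 'E[R]_0 -> \bar R := @dirac _ 'E[R]_0 [tuple] R.

HB.instance Definition _ := Measure.on lebesgue_nil.

Lemma lebesgue_nil_sigma_finite : sigma_finite [set: 'E[R]_0] lebesgue_nil.
Proof.
exists (fun=> setT); first by rewrite bigcup_const.
by move=> k; split => //; rewrite /lebesgue_nil diracT ltry.
Qed.

HB.instance Definition _ :=
  Measure_isSigmaFinite.Build _ _ _ lebesgue_nil lebesgue_nil_sigma_finite.

Fixpoint lebesgue_tuple n : {sigma_finite_measure set 'E[R]_n -> \bar R} :=
  if n is m.+1 return {sigma_finite_measure set 'E[R]_n -> \bar R}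
  then lebesgue_cons (lebesgue_tuple m) else lebesgue_nil.

Lemma lebesgue_tuple_box n (a b : 'E[R]_n) :
  (forall i, tnth a i <= tnth b i) ->
  lebesgue_tuple n [set x | forall i, tnth a i <= tnth x i < tnth b i] =
  (\prod_(i < n) (tnth b i - tnth a i))%:E.
Proof.
elim: n a b => [|n IHn] a b ab /=.
  rewrite big_ord0 /lebesgue_nil diracE mem_set//=.
  by case.
rewrite /lebesgue_cons /pushforward.
pose a' : 'E[R]_n := [tuple of behead a]; pose b' : 'E[R]_n := [tuple of behead b].
rewrite (_ : _ @^-1` _ = `[tnth a ord0, tnth b ord0[%classic `*`
    [set x | forall i, tnth a' i <= tnth x i < tnth b' i]); last first.
  apply/seteqP; split => -[x y] /=.
    move=> H; split; first by have := H ord0; rewrite in_itv.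
    move=> i; have := H (lift ord0 i); rewrite tnthS.
    by rewrite (tuple_eta a) (tuple_eta b) !tnthS.
  rewrite in_itv /= => -[H0 H] i.
  case: (unliftP ord0 i) => [j|] ->; last by [].
  by rewrite tnthS (tuple_eta a) (tuple_eta b) !tnthS; exact: H.
have mbox : measurable [set x | forall i, tnth a' i <= tnth x i < tnth b' i].
  rewrite (_ : [set x | _] = \bigcap_(i in [set: 'I_n])
      ((@tnth n (measurableTypeR R))^~ i @^-1` `[tnth a' i, tnth b' i[%classic)).
    apply: fin_bigcap_measurable => // i _; rewrite -[X in measurable X]setTI.
    by apply: (@measurable_tnth _ (measurableTypeR R) n i measurableT); exact: measurable_itv.
  apply/seteqP; split => x /=.
    by move=> H i _; have := H i; rewrite /= in_itv.
  by move=> H i; have := H i I; rewrite /= in_itv.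
have mI : measurable (`[tnth a ord0, tnth b ord0[%classic : set (measurableTypeR R)).
  exact: measurable_itv.
rewrite product_measure1E//= IHn; last first.
  move=> i; have := ab (lift ord0 i).
  by rewrite (tuple_eta a) (tuple_eta b) !tnthS.
rewrite lebesgue_measure_itv/= lte_fin big_ord_recl EFinM.
congr (_ * _)%E.
  case: ltP => //; have := ab ord0; move=> h1 h2.
  by congr EFin; apply/eqP; rewrite eq_sym subr_eq0; apply/eqP/le_anti; rewrite h1 h2.
congr EFin; apply: eq_bigr => i _.
by rewrite [in RHS](tuple_eta a) [in RHS](tuple_eta b) !tnthS.
Qed.

End lebesgue_tuple.

Section euclidean.
Context {R : realType} {n : nat}.
Implicit Types (x y : 'E[R]_n) (E : set 'E[R]_n) (f A : 'E[R]_n -> R).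

Definition eucl_dist x y : R :=
  Num.sqrt (\sum_(i < n) (tnth x i - tnth y i) ^+ 2).

Definition eucl_diam E : R := sup [set eucl_dist x y | x in E & y in E].

Definition lipschitz_euclidean (L : R) f :=
  forall x y, `|f x - f y| <= L * eucl_dist x y.

Definition affine_map A :=
  exists (v : 'E[R]_n) (b : R),
    forall x, A x = \sum_(i < n) tnth v i * tnth x i + b.

Local Open Scope ereal_scope.

Definition beta_fin f (p : R) E : \bar R :=
  ereal_inf [set ((eucl_diam E ^- n)%:E *
      \int[lebesgue_tuple n]_(x in E) ((`|f x - A x| / eucl_diam E) `^ p)%:E) `^ p^-1
    | A in affine_map].

Definition beta_infty f E : \bar R :=
  ereal_inf [set ereal_sup [set (`|f x - A x| / eucl_diam E)%:E | x in E]
    | A in affine_map].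

(* The exponent ranges over [1, +oo]; the value at -oo is irrelevant. *)
Definition beta f (p : \bar R) E : \bar R :=
  if p is r%:E then beta_fin f r E else beta_infty f E.

End euclidean.

(* The pair (k, m) stands for the half-open cube of side 2 ^ k with lower
   corner 2 ^ k m. For n > 0 distinct pairs give distinct cubes. *)
Definition dyadic n : Type := (int * n.-tuple int)%type.

Section dyadic_cubes.
Context {R : realType} {n : nat}.
Implicit Type Q : dyadic n.

Definition side Q : R := 2 ^ Q.1.

Definition dcube Q : set 'E[R]_n :=
  [set x | forall i, (tnth Q.2 i)%:~R * side Q <= tnth x i
                     < ((tnth Q.2 i)%:~R + 1) * side Q].

Definition dcenter Q (i : 'I_n) : R := ((tnth Q.2 i)%:~R + 2^-1) * side Q.

Definition dilate (C : R) Q : set 'E[R]_n :=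
  [set x | forall i, dcenter Q i - C * side Q / 2 <= tnth x i
                     < dcenter Q i + C * side Q / 2].

Definition vol Q : R := side Q ^+ n.

End dyadic_cubes.

(* Main.v *)
Require Import Defs.
From HB Require Import structures.
From mathcomp Require Import all_boot all_order all_algebra.
From mathcomp Require Import all_classical all_reals all_analysis.
From mathcomp Require Import measurable_realfun zify ring lra.

(** The beta number of a cube measures how far [f] is from affine at one scale,
relative to the size of the cube; the theorem says that the squares of these
defects are summable over positions and scales, with the volume as weight. The
proof is a martingale argument on a fine grid, and never differentiates [f].

Fix a top box and cut it in half, one coordinate at a time and cyclically in
the coordinates, down to grid cubes of side [h]. The boxes form a binary tree;
a box is given by its level [T], counted from the grid cubes upwards, and by
its lower corner [p]. The average [grad d T p] over the box of the difference
quotients of [f] in direction [d] is a martingale bounded by the Lipschitz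
constant [L], so the squares of its increments [delta] have sum at most
[L ^+ 2] ([grad_energy]).

To each box is attached the affine function [affine T p] that has slopes
[grad] and the same mean as [f] on the grid points. Going from a box to one of
its halves changes the slopes by [delta], which is square summable. It also
changes the mean, and at a given scale the slopes do not control this change.
But the averages of [f] over two opposite faces of a box differ exactly by the
side times [grad] ([face_grad]), and the discrepancy [defect] between the mean
over the box and the mean of two opposite face averages satisfies a recursion
in which a level adds only its side times [delta] ([defectS]). Since the
sides grow geometrically with the level, the defect divided by the size of the
box is contracted from one level to the next, up to a term [delta], and its
squares are summable too ([carleson_contraction], [carleson_defect]).

The L^q error of [affine T p] on a box is at most that on its two halves plus
the jump between the affine functions. For q >= 2 the square of the relative
error on the box is then bounded by the average over the two halves, times a
factor as close as desired to 2^(1 - 2/q - 2/n), up to square summable terms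
([majorized_energy]). This factor is less than 1 if n <= 2, and for n > 2
precisely if q < 2n/(n-2); then the relative error contracts as well.
Exponents below 2 follow from q = 2 ([majorized_low]), and for n = 1 the same
recursion runs in the sup norm, with a factor as close as desired to 1/2
([error_sup]).

Finally, [dilate C Q] lies in the concentric cube of side [M] times that of
[Q], for an odd integer [M] at least [C]. Because [M] is odd, these larger
cubes for all dyadic subcubes of a given cube are distinct nodes of boundedly
many of the trees above ([odd_residue], [node_in_tree], [node_inj]), and
summing over nodes of a tree is what the estimates control
([tree_packing]). *)

Set Implicit Arguments.
Unset Strict Implicit.
Unset Printing Implicit Defensive.
Import Order.TTheory GRing.Theory Num.Theory.
Import numFieldNormedType.Exports.

Local Open Scope classical_set_scope.
Local Open Scope ring_scope.

(** * Elementary inequalities *)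

Lemma sqr_addr_le (R : realFieldType) (t x y : R) : 0 < t ->
  (x + y) ^+ 2 <= (1 + t) * x ^+ 2 + (1 + t^-1) * y ^+ 2.
Proof.
move=> t0; have -> : y = t * (y / t) by rewrite mulrCA divff ?gt_eqF ?mulr1.
set z := y / t.
have -> : (1 + t) * x ^+ 2 + (1 + t^-1) * (t * z) ^+ 2 =
   (x + t * z) ^+ 2 + t * (x - z) ^+ 2 by field; rewrite gt_eqF.
by rewrite lerDl mulr_ge0 ?sqr_ge0 // ltW.
Qed.

Lemma sqr_sum_le (R : realFieldType) (I : finType) (x : I -> R) :
  (\sum_i x i) ^+ 2 <= #|I|%:R * \sum_i x i ^+ 2.
Proof.
rewrite expr2 mulr_suml.
apply: (@le_trans _ _ (\sum_i (\sum_j (x i ^+ 2 + x j ^+ 2) / 2))).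
  apply: ler_sum => i _; rewrite mulr_sumr; apply: ler_sum => j _.
  by have := sqr_ge0 (x i - x j); nra.
rewrite le_eqVlt; apply/orP; left; apply/eqP.
under eq_bigr => i _ do
  rewrite -mulr_suml big_split /= sumr_const -[x i ^+ 2 *+ _]mulr_natl.
rewrite -mulr_suml big_split /= sumr_const -mulr_sumr -[(\sum_i _) *+ _]mulr_natl.
by field.
Qed.

Lemma powR_superadd (R : realType) (r x y : R) : 1 <= r -> 0 <= x -> 0 <= y ->
  x `^ r + y `^ r <= (x + y) `^ r.
Proof.
move=> r1 x0 y0; have r0 : 0 < r by lra.
have H z t : 0 <= z -> 0 <= t -> z `^ r <= z * (z + t) `^ (r - 1).
  move=> z0 t0; rewrite -(mulr_powRB1 z0 r0) ler_wpM2l //.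
  by rewrite ge0_ler_powR ?subr_ge0 ?nnegrE ?addr_ge0 // lerDl.
rewrite -(mulr_powRB1 (addr_ge0 x0 y0) r0) mulrDl lerD ?H //.
by rewrite [x + y]addrC H.
Qed.

(** Compare [y] with [t * x]. The factor in front of [x `^ q] can be made as
close to 1 as desired, which keeps the contraction factors below 1. *)
Lemma powR_addr_le (R : realType) (t q x y : R) : 0 < t -> 0 <= q ->
  0 <= x -> 0 <= y ->
  (x + y) `^ q <= (1 + t) `^ q * x `^ q + (1 + t^-1) `^ q * y `^ q.
Proof.
move=> t0 q0 x0 y0; have ti0 : 0 < t^-1 by rewrite invr_gt0.
have [yx|xy] := leP y (t * x).
  rewrite -powRM ?addr_ge0 ?(ltW t0) // -[leLHS]addr0 lerD //; last first.
    by rewrite mulr_ge0 ?powR_ge0.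
  by rewrite ge0_ler_powR ?nnegrE ?addr_ge0 ?mulr_ge0 ?addr_ge0 ?(ltW t0) //; lra.
rewrite -[X in _ <= _ + X]powRM ?addr_ge0 ?(ltW ti0) // -[leLHS]add0r lerD //.
  by rewrite mulr_ge0 ?powR_ge0.
rewrite ge0_ler_powR ?nnegrE ?addr_ge0 ?mulr_ge0 ?addr_ge0 ?(ltW ti0) //.
rewrite mulrDl mul1r addrC lerD2l.
by rewrite -(ler_pM2l t0) mulrA divff ?gt_eqF // mul1r ltW.
Qed.

Lemma sqr_powR (R : realType) (q x : R) : 0 <= x -> (x ^+ 2) `^ (q / 2) = x `^ q.
Proof.
move=> x0; rewrite -powR_mulrn // -powRrM; congr (_ `^ _).
by rewrite mulrC divfK // pnatr_eq0.
Qed.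

Lemma contraction_slack (R : realFieldType) (tau : R) : 0 < tau < 1 ->
  exists2 t : R, 0 < t & 0 < (1 + t) ^+ 2 * tau < 1.
Proof.
move=> /andP[tau0 tau1]; exists ((1 - tau) / 4); first by rewrite divr_gt0 ?subr_gt0.
apply/andP; split; first by rewrite mulr_gt0 // exprn_gt0 // addr_gt0 // divr_gt0 ?subr_gt0.
set t := (1 - tau) / 4; have -> : tau = 1 - 4 * t by rewrite /t; field.
have t0 : 0 < t by rewrite divr_gt0 ?subr_gt0.
by nra.
Qed.

Section SeqSums.
Context {R : realDomainType} {I : eqType}.
Implicit Types (F : I -> R) (s : seq I) (P A B : pred I).

Lemma ler_sum_pred_or F s P A B : (forall i, 0 <= F i) ->
  (forall i, P i -> A i || B i) ->
  \sum_(i <- s | P i) F i <= \sum_(i <- s | A i) F i + \sum_(i <- s | B i) F i.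
Proof.
move=> F0 PAB; rewrite big_mkcond [X in _ <= X + _]big_mkcond.
rewrite [X in _ <= _ + X]big_mkcond -big_split /=; apply: ler_sum => i _.
have := PAB i; have Fi := F0 i; have [_|nP _] := boolP (P i).
  move/(_ isT); case: (A i) (B i) => -[] //= _;
    by rewrite ?addr0 ?add0r ?lerDl.
by rewrite addr_ge0 //; case: ifP.
Qed.

Lemma sum_pred1_le F s a : uniq s -> (forall i, 0 <= F i) ->
  \sum_(i <- s | i == a) F i <= F a.
Proof.
move=> us F0; have [sa|sa] := boolP (a \in s).
  by rewrite -big_filter filter_pred1_uniq ?big_seq1.
rewrite big_seq_cond big_pred0 // => i.
by apply/negP => /andP[si /eqP ia]; rewrite -ia si in sa.
Qed.
End SeqSums.

Section Integral.
Context {d : measure_display} {T : measurableType d} {R : realType}.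
Variable mu : {measure set T -> \bar R}.
Local Open Scope ereal_scope.

(** The integral of a nonnegative function is a supremum over the simple
functions below it, so the comparison needs no measurability. Errors of [f]
can thus be integrated through majorants built from boxes. *)
Lemma ge0_le_integral_majorant (D : set T) (F G : T -> \bar R) :
  (forall x, 0 <= F x) -> (forall x, 0 <= G x) ->
  (forall x, D x -> F x <= G x) -> \int[mu]_(x in D) F x <= \int[mu]_x G x.
Proof.
move=> F0 G0 FG; rewrite integral_mkcond !ge0_integralTE //; last first.
  by move=> x; rewrite /patch; case: ifP.
apply: ereal_sup_le => _ [g /= gF <-]; exists g => //= x.
apply: (le_trans (gF x)); rewrite /patch; case: ifPn => // /set_mem.
exact: FG.
Qed.
End Integral.

(** * Translations *)

Section Translate.
Context {R : realType} {n : nat}.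
Implicit Types (p : 'E[R]_n) (d : 'I_n) (t : R).

(** Reads coordinates in [R] itself rather than in its copy that carries the
Borel sets, so that they take part in ring expressions. *)
Definition coord p i : R := tnth p i.

Lemma eq_from_coord p q : (forall i, coord p i = coord q i) -> p = q.
Proof. by move=> pq; apply: eq_from_tnth. Qed.

Definition translate d t p : 'E[R]_n :=
  [tuple coord p i + (if i == d then t else 0) | i < n].

Lemma coord_translate d t p i :
  coord (translate d t p) i = coord p i + (if i == d then t else 0).
Proof. by rewrite /coord tnth_mktuple. Qed.

Lemma translateD d s t p : translate d s (translate d t p) = translate d (s + t) p.
Proof.
apply: eq_from_coord => i; rewrite !coord_translate -addrA.
by case: (i == d); rewrite ?addr0 // (addrC t).
Qed.

Lemma translateC d s e t p : translate d s (translate e t p) = translate e t (translate d s p).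
Proof. by apply: eq_from_coord => i; rewrite !coord_translate addrAC. Qed.

Lemma eucl_dist_translate d t p : eucl_dist (translate d t p) p = `|t|.
Proof.
rewrite /eucl_dist (bigD1 d) //= big1 ?addr0 => [|i id].
  by rewrite -!/(coord _ _) coord_translate eqxx addrAC subrr add0r sqrtr_sqr.
by rewrite -!/(coord _ _) coord_translate (negPf id) addr0 subrr expr0n.
Qed.

Lemma eucl_dist_le (x y : 'E[R]_n) (s : R) :
  (forall i, `|coord x i - coord y i| <= s) -> eucl_dist x y <= n%:R * s.
Proof.
move=> xys; have s0 : 'I_n -> 0 <= s by move=> i; apply: le_trans (xys i).
have ns0 : 0 <= n%:R * s.
  by case: n s0 {xys x y} => [_|m /(_ ord0) ?]; rewrite ?mul0r // mulr_ge0.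
rewrite -(@ger0_norm _ (n%:R * s)) // -sqrtr_sqr ler_wsqrtr //.
apply: (@le_trans _ _ (\sum_(i < n) s ^+ 2)).
  apply: ler_sum => i _.
  by rewrite -real_normK ?num_real // lerXn2r ?nnegrE // s0.
rewrite sumr_const card_ord exprMn -[leLHS]mulr_natl ler_wpM2r ?sqr_ge0 //.
by rewrite -natrX ler_nat; case: n => // m; rewrite expnS leq_pmulr // expn_gt0.
Qed.
End Translate.

(** * The binary tree of grid boxes *)

Section BinaryTree.
Context {R : realType} {n' : nat}.
Local Notation n := n'.+1.
Local Notation pt := 'E[R]_n.
Variable h : R.
Implicit Types (p x : pt) (T : nat) (d i : 'I_n).

Definition axis T : 'I_n := inZp T.

(** The number of levels [S < T] with [axis S = d]. *)
Definition depth d T : nat := (T %/ n + (d < T %% n))%N.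

Definition cell_side d T : R := h * 2 ^+ depth d T.

(** Boxes of level [T.+1] are cut across [axis T]: the box with corner [p] has
two halves of level [T], with corners [p] and [step T p]. *)
Definition step T p : pt := translate (axis T) (cell_side (axis T) T) p.

(** The average of [u] over the grid points of the box, which are the lower
corners of the grid cubes inside it. *)
Fixpoint avg (u : pt -> R) T p : R :=
  if T is T'.+1 then (avg u T' p + avg u T' (step T' p)) / 2 else u p.

(** The sum over the levels up to [T] of the average of [Z] over the nodes of
that level below the box. *)
Fixpoint carleson (Z : nat -> pt -> R) T p : R :=
  if T is T'.+1
  then (carleson Z T' p + carleson Z T' (step T' p)) / 2 + Z T p
  else Z 0%N p.

Lemma depthS d T : depth d T.+1 = (depth d T + (d == axis T))%N.
Proof.
have dn := ltn_ord d; have Tn : (T %% n < n)%N by rewrite ltn_mod.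
have -> : (d == axis T) = (d == T %% n :> nat)%N by [].
rewrite /depth {1 2}(divn_eq T n) -addnS divnMDl // modnMDl -addnA -addnA.
move: Tn; move: (T %% n)%N => r rn; congr addn.
have [lt|ge] := ltnP r.+1 n.
  by rewrite (divn_small lt) (modn_small lt) ltnS leq_eqVlt; case: ltngtP.
have -> : r = n' by apply/eqP; rewrite eqn_leq -ltnS rn -ltnS ge.
by rewrite divnn modnn /=; move: dn; rewrite ltnS leq_eqVlt; case: ltngtP.
Qed.

Lemma depthMn d k : depth d (n * k) = k.
Proof. by rewrite /depth mulKn // modnMr addn0. Qed.

Lemma sideS d T : cell_side d T.+1 = if d == axis T then 2 * cell_side d T else cell_side d T.
Proof.
rewrite /cell_side depthS; case: (d == axis T); rewrite ?addn0 // addn1 exprS.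
by rewrite mulrCA.
Qed.

Lemma side0 d : cell_side d 0%N = h.
Proof. by rewrite /cell_side /depth div0n mod0n addn0 expr0 mulr1. Qed.

Lemma depth_mono d T T' : (T <= T')%N -> (depth d T <= depth d T')%N.
Proof.
move=> /subnK <-; elim: (T' - T)%N => [//|k IH].
by rewrite addSn depthS (leq_trans IH) ?leq_addr.
Qed.

(** * Carleson sums *)

Lemma carlesonD (Y Z : nat -> pt -> R) T p :
  carleson (fun T p => Y T p + Z T p) T p = carleson Y T p + carleson Z T p.
Proof. by elim: T p => [|T IH] p //=; rewrite !IH; field. Qed.

Lemma carlesonZ (c : R) (Z : nat -> pt -> R) T p :
  carleson (fun T p => c * Z T p) T p = c * carleson Z T p.
Proof. by elim: T p => [|T IH] p //=; rewrite !IH; field. Qed.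

Lemma carleson_sum (I : finType) (Z : I -> nat -> pt -> R) T p :
  carleson (fun T p => \sum_i Z i T p) T p = \sum_i carleson (Z i) T p.
Proof.
elim: T p => [|T IH] p //=.
by rewrite !IH mulrDl !mulr_suml -!big_split /=; apply: eq_bigr => i _; field.
Qed.

(** A quantity [Y T p] that describes how the box of level [T.+1] splits is
counted at level [T.+1]; [c] fills the level of the leaves. *)
Definition prepend (c : R) (Y : nat -> pt -> R) T p : R :=
  if T is T'.+1 then Y T' p else c.

(** Averages of averages are averages over the lower level, so summing the
recursion over the tree gives a geometric series. *)
Lemma carleson_contraction (rho c : R) (Z Y : nat -> pt -> R) T p :
  0 < rho < 1 -> (forall p, 0 <= Z 0%N p <= c) ->
  (forall T p, 0 <= Z T p) ->
  (forall T p, Z T.+1 p <= rho * ((Z T p + Z T (step T p)) / 2) + Y T p) ->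
  (1 - rho) * carleson Z T p <= carleson (prepend c Y) T p.
Proof.
move=> /andP[r0 r1] Z0 Zge ZS.
(* The term rho * Z T p is what the next level takes from this one. *)
suff H : (1 - rho) * carleson Z T p + rho * Z T p <= carleson (prepend c Y) T p.
  by have := mulr_ge0 (ltW r0) (Zge T p); lra.
elim: T p => [|T IH] p /=; first by have /andP[] := Z0 p; lra.
have := IH p; have := IH (step T p); have := ZS T p; lra.
Qed.

Lemma carleson_avg (Z : nat -> pt -> R) T p :
  carleson (prepend 0 (fun T p => (Z T p + Z T (step T p)) / 2)) T p + Z T p =
  carleson Z T p.
Proof.
elim: T p => [|T IH] p; first by rewrite /= add0r.
by rewrite [carleson Z _ _]/= -!IH /=; field.
Qed.

Lemma carleson_prepend (c : R) (Y : nat -> pt -> R) T p :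
  carleson (prepend c Y) T p = c + carleson (prepend 0 Y) T p.
Proof. by elim: T p => [|T IH] p /=; rewrite ?addr0 // !IH; field. Qed.

Lemma carleson_prependD (Y Z : nat -> pt -> R) T p :
  carleson (prepend 0 (fun T p => Y T p + Z T p)) T p =
  carleson (prepend 0 Y) T p + carleson (prepend 0 Z) T p.
Proof.
rewrite -carlesonD; congr carleson; apply/funext => -[|S]; apply/funext => q //=.
by rewrite addr0.
Qed.

Lemma carleson_prependZ (c : R) (Z : nat -> pt -> R) T p :
  carleson (prepend 0 (fun T p => c * Z T p)) T p = c * carleson (prepend 0 Z) T p.
Proof.
rewrite -carlesonZ; congr carleson; apply/funext => -[|S]; apply/funext => q //=.
by rewrite mulr0.
Qed.

Lemma carleson_prepend_sum (I : finType) (Z : I -> nat -> pt -> R) T p :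
  carleson (prepend 0 (fun T p => \sum_i Z i T p)) T p =
  \sum_i carleson (prepend 0 (Z i)) T p.
Proof.
rewrite -carleson_sum; congr carleson; apply/funext => -[|S]; apply/funext => q //=.
by rewrite big1.
Qed.

(** * Sums over distinct nodes *)

Fixpoint in_tree T p (k : nat * pt) : bool :=
  (k == (T, p)) ||
  (if T is T'.+1 then in_tree T' p k || in_tree T' (step T' p) k else false).

(** There are [2 ^+ T] leaves below a node of level [T], so with this weight
the averages in [carleson] become a sum over distinct nodes. *)
Lemma tree_packing (Z : nat -> pt -> R) (s : seq (nat * pt)) T p :
  uniq s -> (forall T p, 0 <= Z T p) ->
  \sum_(k <- s | in_tree T p k) 2 ^+ k.1 * Z k.1 k.2 <=
  2 ^+ T * carleson Z T p.
Proof.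
move=> us Z0.
have F0 (k : nat * pt) : 0 <= 2 ^+ k.1 * Z k.1 k.2 by rewrite mulr_ge0 ?exprn_ge0.
elim: T p => [|T IH] p.
  apply: le_trans (sum_pred1_le (0%N, p) us F0).
  by rewrite le_eqVlt; apply/orP; left; apply/eqP/eq_bigl => k; rewrite /= orbF.
have := ler_sum_pred_or s F0 (fun k (H : in_tree T.+1 p k) => H).
move/le_trans; apply.
have /= := @ler_sum_pred_or _ _ _ s (fun k => in_tree T p k || in_tree T (step T p) k)
  (in_tree T p) (in_tree T (step T p)) F0 (fun k H => H).
have := sum_pred1_le (T.+1, p) us F0; have := IH p; have := IH (step T p).
by rewrite /= !exprS; lra.
Qed.

(** The coordinates of a node are multiples of its sides; cutting the top box
reads off the leading binary digit of one of these multiples. *)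
Lemma in_tree_translate T p T' p' (t : 'I_n -> nat) : (T' <= T)%N ->
  (forall d, (t d < 2 ^ (depth d T - depth d T'))%N) ->
  (forall d, coord p' d = coord p d + (t d)%:R * cell_side d T') ->
  in_tree T p (T', p').
Proof.
elim: T p p' t => [|T IH] p p' t.
  rewrite leqn0 => /eqP -> t0 p'E; rewrite /= orbF; apply/eqP; congr pair.
  apply: eq_from_coord => d; rewrite p'E; have := t0 d.
  by rewrite subnn expn0 ltnS leqn0 => /eqP ->; rewrite mul0r addr0.
rewrite leq_eqVlt => /orP[/eqP -> t0 p'E|].
  apply/orP; left; apply/eqP; congr pair.
  apply: eq_from_coord => d; rewrite p'E; have := t0 d.
  by rewrite subnn expn0 ltnS leqn0 => /eqP ->; rewrite mul0r addr0.
rewrite ltnS => T'T tT p'E; apply/orP; right.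
set k := (depth (axis T) T - depth (axis T) T')%N.
have tE d : d != axis T -> (t d < 2 ^ (depth d T - depth d T'))%N.
  by move=> dT; have := tT d; rewrite depthS (negPf dT) addn0.
have tA : (t (axis T) < 2 ^ k + 2 ^ k)%N.
  have := tT (axis T); rewrite depthS eqxx addn1 subSn ?depth_mono //.
  by rewrite expnS mul2n addnn.
have [lt|ge] := ltnP (t (axis T)) (2 ^ k).
  apply/orP; left; apply: (IH _ _ t) => // d.
  by have [->|] := eqVneq d (axis T); [|exact: tE].
apply/orP; right.
apply: (IH _ _ (fun d => if d == axis T then t d - 2 ^ k else t d)%N) => // d.
  by have [->|dT] := eqVneq d (axis T); [rewrite ltn_subLR | exact: tE].
rewrite p'E coord_translate; have [->|dT] := eqVneq d (axis T); last by rewrite addr0.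
rewrite natrB // mulrBl -addrA; congr (_ + _); rewrite addrC.
have -> : cell_side (axis T) T = (2 ^ k)%:R * cell_side (axis T) T'.
  rewrite /cell_side mulrCA natrX -exprD /k subnK //; exact: depth_mono.
by ring.
Qed.

Hypothesis h0 : 0 < h.

(** * Geometry of the boxes *)

(** The factor by which sizes grow per level: [n] levels double every side. *)
Definition kappa : R := 2 `^ (n%:R^-1).

Lemma kappaXn : kappa ^+ n = 2.
Proof.
by rewrite -powR_mulrn ?powR_ge0 // -powRrM mulVf ?powRr1 // pnatr_eq0.
Qed.

Lemma kappa_gt1 : 1 < kappa.
Proof.
rewrite ltNge; apply/negP => k1.
have : kappa ^+ n <= 1 by rewrite exprn_ile1 ?powR_ge0.
by rewrite kappaXn; lra.
Qed.

Lemma kappa_gt0 : 0 < kappa. Proof. by have := kappa_gt1; lra. Qed.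

(** The side of the cube with the same volume as the box. It replaces the
unequal sides by a geometric progression in the level. *)
Definition cell_size T : R := h * kappa ^+ T.

Lemma size_gt0 T : 0 < cell_size T.
Proof. by rewrite mulr_gt0 // exprn_gt0 ?kappa_gt0. Qed.

Lemma sizeS T : cell_size T.+1 = kappa * cell_size T.
Proof. by rewrite /cell_size exprS mulrCA. Qed.

Lemma side_le_size d T : cell_side d T <= 2 * cell_size T.
Proof.
rewrite /cell_side /cell_size mulrCA ler_pM2l // /depth exprD mulrC.
apply: ler_pM; rewrite ?exprn_ge0 //.
  by case: (d < _)%N; rewrite ?expr1 ?expr0 ?ler1n.
by rewrite -kappaXn -exprM ler_eXn2l ?kappa_gt1 // mulnC leq_trunc_div.
Qed.

Lemma prod_side T : \prod_d cell_side d T = cell_size T ^+ n.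
Proof.
elim: T => [|T IH].
  under eq_bigr do rewrite side0.
  by rewrite prodr_const card_ord /cell_size expr0 mulr1.
rewrite sizeS exprMn kappaXn -IH (bigD1 (axis T)) //= [in RHS](bigD1 (axis T)) //=.
rewrite sideS eqxx mulrA; congr (_ * _).
by apply: eq_bigr => d /negPf dT; rewrite sideS dT.
Qed.

Definition cell T p : set pt :=
  [set x | forall d, coord p d <= coord x d < coord p d + cell_side d T].

Lemma side_ge d T : h <= cell_side d T.
Proof. by rewrite /cell_side ler_peMr ?(ltW h0) // exprn_ege1 // ler1n. Qed.

Lemma cellS T p : cell T.+1 p = cell T p `|` cell T (step T p).
Proof.
apply/seteqP; split=> x /=.
  move=> cx; have /andP[x1 x2] := cx (axis T).
  have [xlt|xge] := ltP (coord x (axis T)) (coord p (axis T) + cell_side (axis T) T).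
    left=> d; have [->|dT] := eqVneq d (axis T); first by rewrite x1.
    by have := cx d; rewrite sideS (negPf dT).
  right=> d; rewrite coord_translate; have := cx d; rewrite sideS.
  have [->|dT] := eqVneq d (axis T); last by rewrite addr0.
  by move=> /andP[_ ub]; apply/andP; split; lra.
have s0 d : 0 < cell_side d T by apply: lt_le_trans (side_ge d T).
case=> cx d; have /andP[x1 x2] := cx d; have := s0 d; rewrite sideS.
  by case: ifP => _ sd; apply/andP; split; lra.
move: x1 x2; rewrite coord_translate.
by case: eqVneq => [->|_] x1 x2 sd; apply/andP; split; lra.
Qed.

Local Notation leb := (lebesgue_tuple n : {measure set pt -> \bar R}).

Lemma measurable_cell T p : measurable (cell T p).
Proof.
rewrite (_ : cell T p = \bigcap_(i in [set: 'I_n])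
  ((@tnth n (measurableTypeR R))^~ i @^-1` `[coord p i, coord p i + cell_side i T[%classic)).
  apply: fin_bigcap_measurable => // i _; rewrite -[X in measurable X]setTI.
  by apply: (@measurable_tnth _ (measurableTypeR R) n i measurableT); exact: measurable_itv.
apply/seteqP; split => x /=.
  by move=> H i _; have := H i; rewrite /= in_itv.
by move=> H i; have := H i I; rewrite /= in_itv.
Qed.

Lemma measure_cell T p : leb (cell T p) = (cell_size T ^+ n)%:E.
Proof.
pose b : pt := [tuple coord p i + cell_side i T | i < n].
have bE i : coord b i = coord p i + cell_side i T by rewrite /coord tnth_mktuple.
have -> : cell T p = [set x | forall i, tnth p i <= tnth x i < tnth b i].
  by apply/seteqP; split=> x H i; have := H i; rewrite -!/(coord _ _) bE.
apply: (etrans (@lebesgue_tuple_box R n p b _)) => [i|].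
  by rewrite -!/(coord _ _) bE lerDl (le_trans (ltW h0)) // side_ge.
congr EFin; rewrite -prod_side; apply: eq_bigr => i _.
by rewrite -!/(coord _ _) bE addrAC subrr add0r.
Qed.

Variable f : pt -> R.

(** * Affine approximations *)

Definition grad d T p : R := avg (fun q => (f (translate d h q) - f q) / h) T p.

Definition delta d T p : R := (grad d T (step T p) - grad d T p) / 2.

(** The average of [f] over the grid points of the lower face of the box
orthogonal to direction [d]. *)
Fixpoint face d T p : R :=
  if T is T'.+1 then
    if d == axis T' then face d T' p
    else (face d T' p + face d T' (step T' p)) / 2
  else f p.

(** The error of the trapezoidal rule in direction [d] for the mean of [f]
over the box. The term with [h / 2] is there because each grid cube is
represented by its lower corner. *)
Definition defect d T p : R :=
  (face d T p + face d T (translate d (cell_side d T) p)) / 2 -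
  h / 2 * grad d T p - avg f T p.

Lemma stepE T p : step T p = translate (axis T) (cell_side (axis T) T) p.
Proof. by []. Qed.

Lemma translate_step d t T p : translate d t (step T p) = step T (translate d t p).
Proof. by rewrite !stepE translateC. Qed.

Lemma gradS d T p :
  grad d T.+1 p = (grad d T p + grad d T (step T p)) / 2.
Proof. by []. Qed.

(** The difference quotients telescope along the lines in direction [d]. *)
Lemma face_grad d T p :
  face d T (translate d (cell_side d T) p) - face d T p = cell_side d T * grad d T p.
Proof.
elim: T p => [|T IH] p.
  by rewrite side0 /grad /= mulrCA divff ?gt_eqF // mulr1.
rewrite gradS sideS /=.
have [dT|dT] := eqVneq d (axis T).
  rewrite stepE -dT.
  have := IH p; have := IH (translate d (cell_side d T) p).
  by rewrite translateD mulr_natl mulr2n; lra.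
rewrite -translate_step.
by have := IH p; have := IH (step T p); lra.
Qed.

Lemma defect0 d p : defect d 0%N p = 0.
Proof.
by rewrite /defect side0 /grad /=; field; rewrite gt_eqF.
Qed.

(** When two boxes are merged along [d], their common face disappears from the
trapezoidal rule; what is left is a second difference of face averages, which
[face_grad] turns into the increment of [grad]. *)
Lemma defectS d T p :
  defect d T.+1 p = (defect d T p + defect d T (step T p)) / 2 +
    (if d == axis T then cell_side d T / 2 * delta d T p else 0).
Proof.
rewrite /defect gradS sideS /delta /=.
have [dT|dT] := eqVneq d (axis T); last first.
  by rewrite -translate_step; field.
rewrite stepE -dT.
have := face_grad d T p; have := face_grad d T (translate d (cell_side d T) p).
by rewrite translateD mulr_natl mulr2n; lra.
Qed.

(** The shared face drops out of the difference of the two trapezoidal rules,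
which leaves the difference of the outer faces of the merged box, that is its
slope. *)
Lemma sibling_mean T p :
  avg f T (step T p) - avg f T p = cell_side (axis T) T * grad (axis T) T.+1 p -
   (defect (axis T) T (step T p) - defect (axis T) T p)
   - h * delta (axis T) T p.
Proof.
rewrite /defect gradS /delta stepE; set d := axis T.
have := face_grad d T p; have := face_grad d T (translate d (cell_side d T) p).
by rewrite translateD; lra.
Qed.

(** The coordinates of [x] relative to the barycentre of the grid points of
the box. *)
Definition offset T p x d : R := coord x d - coord p d - (cell_side d T - h) / 2.

Definition affine T p x : R :=
  avg f T p + \sum_d grad d T p * offset T p x d.

(** A bound, valid on each half of a box, for the difference between the affine
function of the box and that of the half. *)
Definition affine_gap T p : R :=
  (`|defect (axis T) T p| + `|defect (axis T) T (step T p)|) / 2 +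
  2 * \sum_d cell_side d T * `|delta d T p|.

Lemma affine_lower T p x :
  affine T.+1 p x - affine T p x =
  - (defect (axis T) T (step T p) - defect (axis T) T p
   + h * delta (axis T) T p) / 2 + \sum_d delta d T p * offset T p x d.
Proof.
have Hd d : grad d T.+1 p - grad d T p = delta d T p.
  by rewrite gradS /delta; field.
have -> : affine T.+1 p x = avg f T.+1 p + \sum_d grad d T.+1 p * offset T p x d -
    cell_side (axis T) T / 2 * grad (axis T) T.+1 p.
  rewrite /affine -addrA; congr (_ + _).
  rewrite (bigD1 (axis T)) // [in RHS](bigD1 (axis T)) //= /offset sideS eqxx.
  under eq_bigr => d dT do rewrite sideS (negPf dT).
  by lra.
have -> : affine T p x = avg f T p + \sum_d grad d T p * offset T p x d by [].
under [X in _ = _ + X]eq_bigr => d _ do rewrite -Hd mulrBl.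
rewrite sumrB /=.
have := sibling_mean T p; lra.
Qed.

Lemma affine_upper T p x :
  affine T.+1 p x - affine T (step T p) x =
  (defect (axis T) T (step T p) - defect (axis T) T p
   + h * delta (axis T) T p) / 2 -
  \sum_d delta d T p * offset T (step T p) x d.
Proof.
have Hd d : grad d T (step T p) - grad d T.+1 p = delta d T p.
  by rewrite gradS /delta; field.
have -> : affine T.+1 p x = avg f T.+1 p +
   \sum_d grad d T.+1 p * offset T (step T p) x d +
    cell_side (axis T) T / 2 * grad (axis T) T.+1 p.
  rewrite /affine -addrA; congr (_ + _).
  rewrite (bigD1 (axis T)) // [in RHS](bigD1 (axis T)) //= /offset sideS eqxx.
  rewrite coord_translate eqxx.
  under eq_bigr => d dT do rewrite sideS (negPf dT).
  under [in RHS]eq_bigr => d dT do rewrite coord_translate (negPf dT) addr0.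
  by lra.
have -> : affine T (step T p) x = avg f T (step T p) +
  \sum_d grad d T (step T p) * offset T (step T p) x d by [].
under [X in _ = _ - X]eq_bigr => d _ do rewrite -Hd mulrBl.
rewrite sumrB /=.
have := sibling_mean T p; lra.
Qed.

Lemma offset_le T p x d : cell T p x -> `|offset T p x d| <= cell_side d T.
Proof.
move=> /(_ d) /andP[x1 x2]; have hs := side_ge d T.
rewrite /offset ler_norml; apply/andP; split; have H0 := h0; lra.
Qed.

Lemma sum_delta_offset T p q x : cell T q x ->
  `|\sum_d delta d T p * offset T q x d| <= \sum_d cell_side d T * `|delta d T p|.
Proof.
move=> cx; apply: (le_trans (ler_norm_sum _ _ _)); apply: ler_sum => d _.
by rewrite normrM mulrC ler_wpM2r ?offset_le.
Qed.

Lemma axis_delta_le T p :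
  `|h * delta (axis T) T p| <= \sum_d cell_side d T * `|delta d T p|.
Proof.
rewrite normrM gtr0_norm // (bigD1 (axis T)) //= -[leLHS]addr0 lerD //.
  by rewrite ler_wpM2r ?side_ge.
by rewrite sumr_ge0 // => d _; rewrite mulr_ge0 // (le_trans _ (side_ge d T)) ?ltW.
Qed.

Lemma affine_gap_lower T p x : cell T p x ->
  `|affine T.+1 p x - affine T p x| <= affine_gap T p.
Proof.
move=> /(sum_delta_offset p); rewrite affine_lower /affine_gap.
have := axis_delta_le T p; move: (\sum_d cell_side d T * _) (\sum_d delta d T _ * _).
move: (defect _ _ p) (defect _ _ _) (h * _) => a b c s t.
rewrite !ler_norml => /andP[c1 c2] /andP[s1 s2].
have := ler_norm a; have := ler_norm (- a); rewrite normrN.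
have := ler_norm b; have := ler_norm (- b); rewrite normrN.
by move=> b1 b2 a1 a2; apply/andP; split; lra.
Qed.

Lemma affine_gap_upper T p x : cell T (step T p) x ->
  `|affine T.+1 p x - affine T (step T p) x| <= affine_gap T p.
Proof.
move=> /(sum_delta_offset p); rewrite affine_upper /affine_gap.
have := axis_delta_le T p; move: (\sum_d cell_side d T * _) (\sum_d delta d T _ * _).
move: (defect _ _ p) (defect _ _ _) (h * _) => a b c s t.
rewrite !ler_norml => /andP[c1 c2] /andP[s1 s2].
have := ler_norm a; have := ler_norm (- a); rewrite normrN.
have := ler_norm b; have := ler_norm (- b); rewrite normrN.
by move=> b1 b2 a1 a2; apply/andP; split; lra.
Qed.

Lemma affine_map_affine T p : affine_map (affine T p).
Proof.
exists [tuple grad d T p | d < n],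
  (avg f T p + \sum_d grad d T p * (- coord p d - (cell_side d T - h) / 2)) => x.
rewrite /affine /offset addrCA; congr (_ + _); rewrite -big_split /=.
by apply: eq_bigr => d _; rewrite -!/(coord _ _) /coord tnth_mktuple -!/(coord _ _); lra.
Qed.

(** * The square function estimate *)

Definition rel_defect d T p : R := (defect d T p / cell_size T) ^+ 2.

(** Bounds the square of [affine_gap] relative to the size; with the sum over
all directions it has the same form at every level. *)
Definition gap_energy T p : R :=
  2 * (\sum_d (rel_defect d T p + rel_defect d T (step T p)) / 2) +
  32 * n%:R * \sum_d delta d T p ^+ 2.

Lemma gap_energy_ge0 T p : 0 <= gap_energy T p.
Proof.
have S d q : 0 <= rel_defect d T q by exact: sqr_ge0.
rewrite addr_ge0 ?mulr_ge0 // sumr_ge0 // => d _; last exact: sqr_ge0.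
by rewrite divr_ge0 ?addr_ge0.
Qed.

Lemma affine_gap_ge0 T p : 0 <= affine_gap T p.
Proof.
rewrite addr_ge0 ?divr_ge0 ?addr_ge0 // mulr_ge0 // sumr_ge0 // => d _.
by rewrite mulr_ge0 // (le_trans (ltW h0)) ?side_ge.
Qed.

Lemma affine_gap_le T p : (affine_gap T p / cell_size T) ^+ 2 <= gap_energy T p.
Proof.
have s0 := size_gt0 T.
set a := `|defect (axis T) T p| / cell_size T.
set b := `|defect (axis T) T (step T p)| / cell_size T.
set s := \sum_d `|delta d T p|.
have ab0 : 0 <= a /\ 0 <= b by rewrite !divr_ge0 ?(ltW s0).
have sn0 : 0 <= s by rewrite sumr_ge0.
have H : affine_gap T p / cell_size T <= (a + b) / 2 + 4 * s.
  rewrite ler_pdivrMr // /affine_gap [leRHS]mulrDl; apply: lerD.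
    by rewrite /a /b -mulrDl mulrAC divfK ?gt_eqF.
  suff : \sum_d cell_side d T * `|delta d T p| <= 2 * cell_size T * s by lra.
  rewrite mulr_sumr; apply: ler_sum => d _.
  by rewrite ler_wpM2r // side_le_size.
have A0 : 0 <= affine_gap T p / cell_size T by rewrite divr_ge0 ?affine_gap_ge0 ?ltW.
have s2 : s ^+ 2 <= n%:R * \sum_d delta d T p ^+ 2.
  have -> : \sum_d delta d T p ^+ 2 = \sum_d `|delta d T p| ^+ 2.
    by apply: eq_bigr => d _; rewrite real_normK ?num_real.
  by have := sqr_sum_le (fun d => `|delta d T p|); rewrite card_ord.
apply: (@le_trans _ _ (a ^+ 2 + b ^+ 2 + 32 * s ^+ 2)).
  apply: (@le_trans _ _ (((a + b) / 2 + 4 * s) ^+ 2)).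
    by rewrite lerXn2r ?nnegrE // (le_trans A0).
  by have := sqr_ge0 (a - b); have := sqr_ge0 ((a + b) / 2 - 4 * s); nra.
rewrite /gap_energy; apply: lerD; last by lra.
rewrite mulr_sumr (bigD1 (axis T)) //= -[leLHS]addr0; apply: lerD.
  rewrite /rel_defect /a /b !exprMn !real_normK ?num_real //.
  by rewrite le_eqVlt; apply/orP; left; apply/eqP; field; rewrite gt_eqF.
rewrite sumr_ge0 // => d _; rewrite mulr_ge0 // divr_ge0 // addr_ge0 //;
  exact: sqr_ge0.
Qed.

(** Up to a factor [1 + (kappa - 1)] the square of the sum is the square of the
averaged defect, and the growth of the size divides it by [kappa ^+ 2]; this
leaves the factor [kappa^-1]. *)
Lemma rel_defectS d T p :
  rel_defect d T.+1 p <=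
  kappa^-1 * ((rel_defect d T p + rel_defect d T (step T p)) / 2) +
  kappa / (kappa - 1) * delta d T p ^+ 2.
Proof.
have k0 := kappa_gt0; have k1 := kappa_gt1; have s0 := size_gt0 T.
rewrite /rel_defect sizeS defectS //.
set g := defect d T p; set g' := defect d T (step T p).
set b := (X in _ + X).
have b2 : b ^+ 2 <= cell_size T ^+ 2 * delta d T p ^+ 2.
  rewrite /b; case: ifP => _; last by rewrite expr0n /= mulr_ge0 ?sqr_ge0.
  rewrite exprMn ler_wpM2r ?sqr_ge0 // lerXn2r ?nnegrE ?(ltW s0) //.
    by rewrite divr_ge0 // (le_trans (ltW h0)) ?side_ge //.
  by have := side_le_size d T; lra.
have := @sqr_addr_le _ (kappa - 1) ((g + g') / 2) b.
rewrite subr_gt0 => /(_ k1).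
have -> : 1 + (kappa - 1) = kappa by lra.
have -> : 1 + (kappa - 1)^-1 = kappa / (kappa - 1).
  by field; rewrite subr_eq0 gt_eqF.
move=> H; rewrite expr_div_n ler_pdivrMr; last first.
  by rewrite exprn_gt0 // mulr_gt0.
apply: (le_trans H).
have -> : (kappa^-1 * (((g / cell_size T) ^+ 2 + (g' / cell_size T) ^+ 2) / 2) +
  kappa / (kappa - 1) * delta d T p ^+ 2) * (kappa * cell_size T) ^+ 2 =
  kappa * ((g ^+ 2 + g' ^+ 2) / 2) +
  kappa ^+ 2 * (kappa / (kappa - 1) * (cell_size T ^+ 2 * delta d T p ^+ 2)).
  by field; rewrite subr_eq0 !gt_eqF.
have c0 : 0 < kappa / (kappa - 1) by rewrite divr_gt0 // subr_gt0.
apply: lerD.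
  by rewrite ler_pM2l //; have := sqr_ge0 (g - g'); nra.
apply: (@le_trans _ _ (kappa / (kappa - 1) * (cell_size T ^+ 2 * delta d T p ^+ 2))).
  by rewrite ler_pM2l.
rewrite ler_peMl ?exprn_ege1 ?(ltW k1) // mulr_ge0 ?(ltW c0) //.
by rewrite mulr_ge0 ?sqr_ge0.
Qed.

Definition gap_const : R := 2 * n%:R * (kappa / (kappa - 1)) ^+ 2 + 32 * n%:R ^+ 2.

Section ErrorEnergy.
Variables rho K c : R.

(** Satisfies with equality the recursive inequality for the squared relative
error of the affine approximations. *)
Fixpoint error_energy T p : R :=
  if T is T'.+1 then
    rho * ((error_energy T' p + error_energy T' (step T' p)) / 2) +
    K * gap_energy T' p
  else c.

Hypotheses (rho01 : 0 < rho < 1) (K0 : 0 <= K) (c0 : 0 < c).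

Lemma error_energy_gt0 T p : 0 < error_energy T p.
Proof.
have /andP[r0 _] := rho01.
elim: T p => [//|T IH] p /=.
by rewrite ltr_wpDr ?mulr_ge0 ?gap_energy_ge0 // mulr_gt0 // divr_gt0 // addr_gt0.
Qed.

End ErrorEnergy.

(** * Majorants of the approximation error *)

Local Notation err T p x := `|f x - affine T p x|.

(** The integral over the box of the [q]-th power of the error is at most [v],
by means of a measurable majorant. *)
Definition majorized (q : R) T p (v : R) : Prop :=
  exists G : pt -> \bar R, [/\ @measurable_fun _ _ pt (\bar R) setT G, (forall x, (0 <= G x)%E),
    (forall x, cell T p x -> ((err T p x `^ q)%:E <= G x)%E) &
    (\int[leb]_x G x <= v%:E)%E].

(** On each half the sum of the two majorants is at least the one for that half,
and the jump of the affine functions adds a constant on the box. *)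
Lemma majorizedS (q t : R) T p v w : 0 < t -> 0 <= q ->
  majorized q T p v -> majorized q T (step T p) w ->
  majorized q T.+1 p ((1 + t) `^ q * (v + w) +
    (1 + t^-1) `^ q * affine_gap T p `^ q * cell_size T.+1 ^+ n).
Proof.
move=> t0 q0 [G [mG G0 eG vG]] [H [mH H0 eH wH]].
set a := (1 + t) `^ q; set b := (1 + t^-1) `^ q; set g := affine_gap T p.
have a0 : 0 <= a by exact: powR_ge0.
have bg0 : 0 <= b * g `^ q by rewrite mulr_ge0 ?powR_ge0.
have mI : @measurable_fun _ _ pt (\bar R) setT (fun x : pt => (\1_(cell T.+1 p) x : R)%:E).
  by apply/measurable_EFinP; apply: measurable_indic; exact: measurable_cell.
exists (fun x => a%:E * (G x + H x) + (b * g `^ q)%:E * (\1_(cell T.+1 p) x)%:E)%E.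
have GH0 x : (0 <= G x + H x)%E by rewrite adde_ge0.
have mGH : @measurable_fun _ _ pt (\bar R) setT (fun x => G x + H x)%E by exact: emeasurable_funD.
split.
- by apply: emeasurable_funD; apply: emeasurable_funM.
- by move=> x; rewrite adde_ge0 ?mule_ge0 ?lee_fin.
- move=> x cx; rewrite indicE mem_set // mule1.
  have gap_case (e : R) : 0 <= e -> err T.+1 p x <= e + g ->
      err T.+1 p x `^ q <= a * e `^ q + b * g `^ q.
    move=> e0 eg; have g0 : 0 <= g by exact: affine_gap_ge0.
    apply: le_trans (powR_addr_le t0 q0 e0 g0).
    by apply: ge0_ler_powR; rewrite ?nnegrE ?(addr_ge0 e0 g0).
  have tri A A' : `|A' - A| <= g -> `|f x - A'| <= `|f x - A| + g.
    move=> AA; rewrite (_ : f x - A' = (f x - A) - (A' - A)); last by ring.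
    by apply: (le_trans (ler_normB _ _)); rewrite lerD2l.
  move: cx; rewrite cellS // => -[cx|cx].
    apply: (@le_trans _ _ (a * err T p x `^ q + b * g `^ q)%:E).
      by rewrite lee_fin gap_case // tri // affine_gap_lower.
    rewrite EFinD leeD2r // EFinM lee_wpmul2l ?lee_fin //.
    by apply: le_trans (eG _ cx) _; rewrite leeDl.
  apply: (@le_trans _ _ (a * err T (step T p) x `^ q + b * g `^ q)%:E).
    by rewrite lee_fin gap_case // tri // affine_gap_upper.
  rewrite EFinD leeD2r // EFinM lee_wpmul2l ?lee_fin //.
  by apply: le_trans (eH _ cx) _; rewrite leeDr.
- rewrite ge0_integralD //; last 4 first.
  + by move=> x _; rewrite mule_ge0 ?lee_fin.
  + by apply: emeasurable_funM.
  + by move=> x _; rewrite mule_ge0 ?lee_fin.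
  + by apply: emeasurable_funM.
  rewrite !ge0_integralZl_EFin //.
  rewrite ge0_integralD // integral_indic //; last exact: measurable_cell.
  rewrite setIT measure_cell EFinD !EFinM leeD2r //.
  by rewrite lee_wpmul2l ?lee_fin // EFinD leeD.
Qed.

Lemma majorized_le q T p v w : v <= w -> majorized q T p v -> majorized q T p w.
Proof.
move=> vw [G [mG G0 eG Gv]]; exists G; split=> //.
by rewrite (le_trans Gv) // lee_fin.
Qed.

Variable L : R.
Hypotheses (L0 : 0 < L) (lipf : lipschitz_euclidean L f).

Lemma grad0_le d p : `|grad d 0%N p| <= L.
Proof.
rewrite /grad /= normrM normfV (gtr0_norm h0) ler_pdivrMr //.
by have := lipf (translate d h p) p; rewrite eucl_dist_translate (gtr0_norm h0).
Qed.

(** At every splitting the parallelogram identity gives that the mean square of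
the slopes of the halves is the square of the slope plus [delta ^+ 2]. *)
Lemma grad_energy d T p :
  grad d T p ^+ 2 + carleson (prepend 0 (fun T p => delta d T p ^+ 2)) T p <= L ^+ 2.
Proof.
elim: T p => [|T IH] p.
  by rewrite /= addr0 -real_normK ?num_real // lerXn2r ?nnegrE ?grad0_le // ltW.
rewrite gradS /=; have := IH p; have := IH (step T p); rewrite /delta; nra.
Qed.

Lemma affine0_error p x : cell 0%N p x -> `|f x - affine 0%N p x| <= 2 * n%:R * L * h.
Proof.
move=> cx.
have E d : `|coord x d - coord p d| <= h.
  by have := cx d; rewrite side0 ler_norml => /andP[lb ub]; apply/andP; split; lra.
rewrite /affine /offset /=.
apply: (@le_trans _ _ (`|f x - f p| + \sum_(d < n) L * h)).
  rewrite opprD addrA; apply: (le_trans (ler_normB _ _)); rewrite lerD2l.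
  apply: (le_trans (ler_norm_sum _ _ _)); apply: ler_sum => d _.
  by rewrite side0 subrr mul0r subr0 normrM ler_pM // grad0_le.
rewrite sumr_const card_ord -[_ *+ n]mulr_natl.
have := lipf x p; have := eucl_dist_le E.
by move=> /(ler_wpM2l (ltW L0)); lra.
Qed.

Lemma carleson_delta d T p :
  carleson (prepend 0 (fun T p => delta d T p ^+ 2)) T p <= L ^+ 2.
Proof.
apply: le_trans (grad_energy d T p).
by rewrite lerDr sqr_ge0.
Qed.

Lemma carleson_defect d T p :
  carleson (rel_defect d) T p <= (kappa / (kappa - 1)) ^+ 2 * L ^+ 2.
Proof.
have k0 := kappa_gt0; have k1 := kappa_gt1.
have := @carleson_contraction kappa^-1 0 (rel_defect d)
  (fun T p => kappa / (kappa - 1) * delta d T p ^+ 2) T p.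
rewrite invr_gt0 k0 invf_lt1 // k1 => /(_ isT) H.
have {}H := H _ (fun T p => sqr_ge0 _) (rel_defectS d).
rewrite carleson_prependZ in H.
have {}H : (1 - kappa^-1) * carleson (rel_defect d) T p <=
    kappa / (kappa - 1) * L ^+ 2.
  apply: le_trans (H _) _ => [q|].
    by rewrite /rel_defect defect0 // mul0r expr0n /= lexx.
  by rewrite ler_pM2l ?carleson_delta // divr_gt0 ?subr_gt0.
have -> : carleson (rel_defect d) T p =
  kappa / (kappa - 1) * ((1 - kappa^-1) * carleson (rel_defect d) T p).
  by field; rewrite subr_eq0 !gt_eqF.
by rewrite expr2 -[leRHS]mulrA ler_pM2l // divr_gt0 ?subr_gt0.
Qed.

Lemma carleson_gap T p : carleson (prepend 0 gap_energy) T p <= gap_const * L ^+ 2.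
Proof.
rewrite carleson_prependD !carleson_prependZ !carleson_prepend_sum /gap_const.
set S1 := \sum_d _; set S2 := \sum_d _; set c := (_ / _) ^+ 2.
have H1 : S1 <= n%:R * (c * L ^+ 2).
  rewrite mulr_natl -[X in _ *+ X](card_ord n) -sumr_const.
  apply: ler_sum => d _; apply: le_trans (carleson_defect d T p).
  by rewrite -(carleson_avg (rel_defect d) T p) lerDl sqr_ge0.
have H2 : S2 <= n%:R * L ^+ 2.
  rewrite mulr_natl -[X in _ *+ X](card_ord n) -sumr_const.
  by apply: ler_sum => d _; apply: carleson_delta.
have : 32 * n%:R * S2 <= 32 * n%:R * (n%:R * L ^+ 2).
  by rewrite ler_wpM2l // mulr_ge0.
lra.
Qed.

Definition leaf_energy : R := (2 * n%:R * L) ^+ 2.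

Lemma leaf_energy_gt0 : 0 < leaf_energy.
Proof. by rewrite exprn_gt0 // !mulr_gt0. Qed.

Lemma majorized0 q p : 0 <= q ->
  majorized q 0%N p ((leaf_energy * cell_size 0%N ^+ 2) `^ (q / 2) * cell_size 0%N ^+ n).
Proof.
move=> q0; set v := _ `^ _.
have v0 : 0 <= v by exact: powR_ge0.
have vE : v = (2 * n%:R * L * h) `^ q.
  rewrite /v /leaf_energy /cell_size expr0 mulr1 -exprMn sqr_powR //.
  by rewrite !mulr_ge0 // ltW.
have mI : @measurable_fun _ _ pt (\bar R) setT
   (fun x : pt => (\1_(cell 0%N p) x : R)%:E).
  by apply/measurable_EFinP; apply: measurable_indic; exact: measurable_cell.
exists (fun x => v%:E * (\1_(cell 0%N p) x)%:E)%E; split.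
- exact: emeasurable_funM.
- by move=> x; rewrite mule_ge0 ?lee_fin.
- move=> x cx; rewrite indicE mem_set // mule1 lee_fin vE.
  apply: ge0_ler_powR; rewrite ?nnegrE // ?mulr_ge0 // ?(ltW L0) ?(ltW h0) //.
  exact: affine0_error.
- rewrite ge0_integralZl_EFin //.
  rewrite integral_indic //; last exact: measurable_cell.
  by rewrite setIT measure_cell.
Qed.

(** The recursion of [error_energy] contracts and is fed by the summable
[gap_energy]. *)
Lemma carleson_error (rho K : R) T p : 0 < rho < 1 -> 0 <= K ->
  carleson (error_energy rho K leaf_energy) T p <=
  (leaf_energy + K * gap_const * L ^+ 2) / (1 - rho).
Proof.
move=> rho01 K0; have /andP[r0 r1] := rho01.
rewrite ler_pdivlMr ?subr_gt0 // mulrC.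
apply: (le_trans (carleson_contraction T p rho01 (c := leaf_energy)
  (Y := fun T p => K * gap_energy T p) _ _ _)) => [q|S q|S q|] //.
- by rewrite /= lexx ltW ?leaf_energy_gt0.
- exact/ltW/error_energy_gt0/leaf_energy_gt0.
rewrite carleson_prepend carleson_prependZ lerD2l -mulrA.
by rewrite ler_wpM2l // carleson_gap.
Qed.

Section Energy.
Variables (t rho K : R).
Hypotheses (t0 : 0 < t) (r01 : 0 < rho < 1) (Kt : (1 + t^-1) ^+ 2 <= K).
Local Notation energy := (error_energy rho K leaf_energy).

Let K0 : 0 <= K. Proof. by rewrite (le_trans _ Kt) // sqr_ge0. Qed.

Let energy_gt0 T p : 0 < energy T p.
Proof. by apply: error_energy_gt0; rewrite ?leaf_energy_gt0. Qed.

(** The box has twice the volume of a half, so that in the mean of the [q]-th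
powers each half counts with weight 1/2, which is the [q / 2]-th power of
[2 `^ (- (2 / q))]. After that, superadditivity of the power [q / 2], valid as [2 <= q],
gathers all terms into a single power, and the growth of the size provides the
division by [kappa ^+ 2]. *)
Lemma majorized_energy (q : R) : 2 <= q ->
  rho = (1 + t) ^+ 2 * 2 `^ (1 - 2 / q) / kappa ^+ 2 ->
  forall T p,
  majorized q T p ((energy T p * cell_size T ^+ 2) `^ (q / 2) * cell_size T ^+ n).
Proof.
move=> q2 rhoE; have q0 : 0 < q by lra.
have t1 : 0 <= 1 + t by rewrite addr_ge0 // ltW.
have ti1 : 0 <= 1 + t^-1 by rewrite addr_ge0 // invr_ge0 ltW.
have k0 := kappa_gt0; have k1 := kappa_gt1.
elim=> [|T IH] p; first by apply: majorized0; exact: ltW.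
apply: majorized_le (majorizedS t0 (ltW q0) (IH p) (IH (step T p))).
have s0 := size_gt0 T; have sn0 : 0 < cell_size T ^+ n by rewrite exprn_gt0.
have g0 := affine_gap_ge0 T p; have W0 := gap_energy_ge0 T p.
set e0 := energy T p; set e1 := energy T (step T p).
have e00 : 0 < e0 by exact: energy_gt0.
have e10 : 0 < e1 by exact: energy_gt0.
rewrite sizeS [(kappa * _) ^+ n]exprMn kappaXn -/e0 -/e1.
set u := e0 * _; set v := e1 * _.
have u0 : 0 < u by rewrite mulr_gt0 // exprn_gt0.
have v0 : 0 < v by rewrite mulr_gt0 // exprn_gt0.
set tau : R := 2 `^ (- (2 / q)).
have tau0 : 0 < tau by exact: powR_gt0.
have tauE : tau `^ (q / 2) = 2^-1.
  rewrite /tau -powRrM (_ : - (2 / q) * (q / 2) = -1) ?powR_inv1 //.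
  by field; rewrite gt_eqF.
have gW : affine_gap T p `^ q <= (gap_energy T p * cell_size T ^+ 2) `^ (q / 2).
  rewrite -(sqr_powR _ g0); apply: ge0_ler_powR; rewrite ?nnegrE ?sqr_ge0 //.
  - by rewrite divr_ge0 // ltW.
  - by rewrite mulr_ge0 ?sqr_ge0.
  - rewrite -ler_pdivrMr ?exprn_gt0 // -expr_div_n; exact: affine_gap_le.
set w := gap_energy T p * cell_size T ^+ 2 in gW.
have w0 : 0 <= w by rewrite mulr_ge0 ?sqr_ge0.
suff H : ((1 + t) ^+ 2 * tau) `^ (q / 2) * (u `^ (q / 2) + v `^ (q / 2)) +
   ((1 + t^-1) ^+ 2) `^ (q / 2) * w `^ (q / 2) <=
   (error_energy rho K leaf_energy T.+1 p * (kappa * cell_size T) ^+ 2) `^ (q / 2).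
  move/(ler_wpM2r (ltW sn0)): H.
  rewrite powRM ?sqr_ge0 ?(ltW tau0) // tauE !sqr_powR // => H.
  have B0 : 0 <= (1 + t^-1) `^ q by exact: powR_ge0.
  have := ler_wpM2r (ltW sn0) (ler_wpM2l B0 gW).
  lra.
have r1 : 1 <= q / 2 by rewrite ler_pdivlMr // mul1r.
have A0 : 0 <= (1 + t) ^+ 2 * tau by rewrite mulr_ge0 ?sqr_ge0 // ltW.
apply: (@le_trans _ _ (((1 + t) ^+ 2 * tau) `^ (q / 2) * (u + v) `^ (q / 2) +
    ((1 + t^-1) ^+ 2) `^ (q / 2) * w `^ (q / 2))).
  rewrite lerD2r ler_wpM2l ?powR_ge0 //.
  by apply: powR_superadd; rewrite // ltW.
have uv0 : 0 <= u + v by rewrite addr_ge0 // ltW.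
rewrite -!powRM ?sqr_ge0 //.
have Bw0 : 0 <= (1 + t^-1) ^+ 2 * w by rewrite mulr_ge0 // sqr_ge0.
apply: (le_trans (powR_superadd r1 (mulr_ge0 A0 uv0) Bw0)).
have r0 : 0 <= q / 2 by lra.
apply: ge0_ler_powR => //; rewrite ?nnegrE.
- exact: addr_ge0 (mulr_ge0 A0 uv0) Bw0.
- exact: mulr_ge0 (ltW (energy_gt0 _ _)) (sqr_ge0 _).
rewrite /= -/e0 -/e1 rhoE.
have -> : 2 `^ (1 - 2 / q) = 2 * tau :> R.
  by rewrite /tau powRD ?powRr1 // pnatr_eq0 implybT.
have -> : ((1 + t) ^+ 2 * (2 * tau) / kappa ^+ 2 * ((e0 + e1) / 2) +
   K * gap_energy T p) * (kappa * cell_size T) ^+ 2 =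
   (1 + t) ^+ 2 * tau * (u + v) + K * kappa ^+ 2 * w.
  by rewrite /u /v /w; field; rewrite gt_eqF.
rewrite lerD2l ler_wpM2r // (le_trans Kt) // ler_peMr //.
by rewrite exprn_ege1 // ltW.
Qed.

(** With [u] the bound for the mean of the squared error [s ^+ 2], the error
satisfies [s `^ q <= u `^ (q / 2) + u `^ (q / 2 - 1) * s ^+ 2] everywhere:
compare [s ^+ 2] with [u]. *)
Lemma majorized_low (q : R) : 0 < q <= 2 ->
  rho = (1 + t) ^+ 2 / kappa ^+ 2 ->
  forall T p,
  majorized q T p (2 * ((energy T p * cell_size T ^+ 2) `^ (q / 2) * cell_size T ^+ n)).
Proof.
move=> /andP[q0 q2] rhoE T p.
have [|G [mG G0 eG Gv]] := @majorized_energy 2 (lexx _) _ T p.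
  by rewrite divff // subrr powRr0 mulr1.
have s0 := size_gt0 T.
set u := energy T p * cell_size T ^+ 2 in Gv *.
have u0 : 0 < u by rewrite mulr_gt0 ?exprn_gt0 ?energy_gt0.
set a := u `^ (q / 2); set b := u `^ (q / 2 - 1).
have a0 : 0 < a by exact: powR_gt0.
have b0 : 0 < b by exact: powR_gt0.
have abu : a = b * u.
  by rewrite /a /b [_ * u]mulrC mulr_powRB1 ?ltW // divr_gt0.
have mI : @measurable_fun _ _ pt (\bar R) setT
   (fun x : pt => (\1_(cell T p) x : R)%:E).
  by apply/measurable_EFinP; apply: measurable_indic; exact: measurable_cell.
exists (fun x => a%:E * (\1_(cell T p) x)%:E + b%:E * G x)%E; split.
- by apply: emeasurable_funD; apply: emeasurable_funM.
- by move=> x; rewrite adde_ge0 ?mule_ge0 ?lee_fin // ltW.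
- move=> x cx; rewrite indicE mem_set // mule1.
  set e := err T p x; have e0 : 0 <= e by exact: normr_ge0.
  apply: (@le_trans _ _ (a%:E + b%:E * (e `^ 2)%:E)%E); last first.
    by rewrite leeD2l // lee_wpmul2l ?lee_fin ?(ltW b0) //; exact: eG.
  rewrite -EFinM -EFinD lee_fin.
  rewrite -(sqr_powR q e0) -(sqr_powR 2 e0) divff // powRr1 ?sqr_ge0 //.
  have [eu|ue] := leP (e ^+ 2) u.
    rewrite -[leLHS]addr0 lerD ?mulr_ge0 ?sqr_ge0 ?(ltW b0) //.
    by apply: ge0_ler_powR; rewrite ?nnegrE ?sqr_ge0 ?(ltW u0) // divr_ge0 // ltW.
  rewrite -[leLHS]add0r lerD ?(ltW a0) //.
  have e20 : 0 < e ^+ 2 by lra.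
  rewrite -(@mulr_powRB1 _ (e ^+ 2) (q / 2)) ?sqr_ge0 ?divr_gt0 // mulrC.
  rewrite /b ler_wpM2r ?sqr_ge0 // -[q / 2 - 1]opprB !powRN lef_pV2 ?posrE ?powR_gt0 //.
  by apply: ge0_ler_powR; rewrite ?nnegrE ?(ltW u0) ?(ltW e20) ?(ltW ue) //; lra.
- rewrite ge0_integralD //; last 4 first.
  + by move=> x _; rewrite mule_ge0 ?lee_fin // ltW.
  + by apply: emeasurable_funM.
  + by move=> x _; rewrite mule_ge0 ?lee_fin // ltW.
  + by apply: emeasurable_funM.
  rewrite !ge0_integralZl_EFin ?(ltW a0) ?(ltW b0) //.
  rewrite integral_indic //; last exact: measurable_cell.
  rewrite setIT measure_cell mulr_natl mulr2n EFinD EFinM leeD2l //.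
  rewrite abu EFinM -muleA lee_wpmul2l ?lee_fin ?(ltW b0) // -EFinM.
  by move: Gv; rewrite divff // powRr1 // ltW.
Qed.

(** A supremum over two halves is bounded by the sum, so each half counts with
weight 1 in place of the 1/2 of an average; in dimension one
[kappa ^+ 2 = 4] makes up for it. *)
Lemma error_sup : rho = 2 * (1 + t) / kappa ^+ 2 ->
  forall T p x, cell T p x -> err T p x ^+ 2 <= energy T p * cell_size T ^+ 2.
Proof.
move=> rhoE; elim=> [|T IH] p x.
  move=> cx; rewrite /= /leaf_energy -exprMn /cell_size expr0 mulr1.
  rewrite lerXn2r ?nnegrE ?mulr_ge0 ?(ltW L0) ?(ltW h0) //.
  exact: affine0_error.
have s0 := size_gt0 T; have g0 := affine_gap_ge0 T p.
have W0 := gap_energy_ge0 T p.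
have k0 := kappa_gt0; have k1 := kappa_gt1.
have e00 := energy_gt0 T p; have e10 := energy_gt0 T (step T p).
have gW : affine_gap T p ^+ 2 <= gap_energy T p * cell_size T ^+ 2.
  rewrite -ler_pdivrMr ?exprn_gt0 // -expr_div_n; exact: affine_gap_le.
have tri A A' : `|A' - A| <= affine_gap T p ->
    `|f x - A'| ^+ 2 <= (1 + t) * `|f x - A| ^+ 2 + (1 + t^-1) * affine_gap T p ^+ 2.
  move=> AA; apply: le_trans (sqr_addr_le _ _ t0).
  rewrite lerXn2r ?nnegrE ?(addr_ge0 _ g0) //.
  rewrite (_ : f x - A' = (f x - A) - (A' - A)); last by ring.
  by apply: (le_trans (ler_normB _ _)); rewrite lerD2l.
have E : energy T.+1 p * cell_size T.+1 ^+ 2 =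
   (1 + t) * (energy T p * cell_size T ^+ 2) +
   (1 + t) * (energy T (step T p) * cell_size T ^+ 2) +
   kappa ^+ 2 * K * (gap_energy T p * cell_size T ^+ 2).
  by rewrite /= rhoE sizeS; field; rewrite gt_eqF.
have ti : 0 < t^-1 by rewrite invr_gt0.
have Kb : (1 + t^-1) * affine_gap T p ^+ 2 <=
  kappa ^+ 2 * K * (gap_energy T p * cell_size T ^+ 2).
  apply: ler_pM; rewrite ?sqr_ge0 //; first by lra.
  apply: (@le_trans _ _ K).
    by apply: le_trans Kt; rewrite expr2 ler_peMr //; lra.
  by rewrite ler_peMl // exprn_ege1 // ltW.
have sq0 : 0 <= cell_size T ^+ 2 by exact: sqr_ge0.
have m0 := mulr_ge0 (ltW e00) sq0; have m1 := mulr_ge0 (ltW e10) sq0.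
have t1 : 0 <= 1 + t by rewrite addr_ge0 // ltW.
have M0 := mulr_ge0 t1 m0; have M1 := mulr_ge0 t1 m1.
rewrite cellS // E => -[cx|cx].
  have := tri _ _ (affine_gap_lower cx).
  by have := ler_wpM2l t1 (IH _ _ cx); lra.
have := tri _ _ (affine_gap_upper cx).
by have := ler_wpM2l t1 (IH _ _ cx); lra.
Qed.

End Energy.

(** * From majorants to beta numbers *)

Lemma beta_ge0 (p : \bar R) (E : set pt) :
  E !=set0 -> (0 <= beta f p E)%E.
Proof.
move=> [x0 Ex0].
have D0 : 0 <= eucl_diam E.
  rewrite /eucl_diam; have [hs|] := pselect (has_sup [set eucl_dist x y | x in E & y in E]).
    apply: (@le_trans _ _ (eucl_dist x0 x0)); first exact: sqrtr_ge0.
    by apply: (sup_upper_bound hs); exists x0 => //; exists x0.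
  by move/sup_out => ->.
case: p => [q||]; rewrite /= /beta_fin /beta_infty;
  apply: le_ereal_inf_tmp => _ [A _ <-]; rewrite ?poweR_ge0 //.
- apply: (@le_trans _ _ (`|f x0 - A x0| / eucl_diam E)%:E).
    by rewrite lee_fin divr_ge0.
  by apply: ereal_sup_ubound; exists x0.
- apply: (@le_trans _ _ (`|f x0 - A x0| / eucl_diam E)%:E).
    by rewrite lee_fin divr_ge0.
  by apply: ereal_sup_ubound; exists x0.
Qed.

Section BetaBounds.
Variables (T : nat) (p : pt) (E : set pt) (m len e : R).
Hypotheses (m1 : 1 <= m) (len0 : 0 < len) (e0 : 0 < e).
Hypotheses (sizeE : cell_size T = m * len) (Ecell : E `<=` cell T p).
Hypothesis Ediam : len <= eucl_diam E.

Let beta_bound : R := Num.sqrt ((2 * m ^+ n.+1) ^+ 2 * e).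

(** One factor [m] compares the size of the box with the diameter of [E], the
others its volume with the [n]-th power of that diameter. *)
Lemma beta_fin_le (q : R) : 1 <= q ->
  majorized q T p (2 * ((e * cell_size T ^+ 2) `^ (q / 2) * cell_size T ^+ n)) ->
  (beta_fin f q E <= beta_bound%:E)%E.
Proof.
move=> q1 [G [mG G0 eG Gv]].
have q0 : 0 < q by lra.
set D := eucl_diam E; have DE : len <= D by exact: Ediam.
have D0 : 0 < D by exact: lt_le_trans DE.
set v := _ * _ in Gv.
apply: ge_ereal_inf; exists (((D ^- n)%:E * \int[lebesgue_tuple n]_(x in E)
    ((`|f x - affine T p x| / D) `^ q)%:E) `^ q^-1)%E.
  by exists (affine T p) => //; exact: affine_map_affine.
have Dq0 : 0 < D `^ (- q) by exact: powR_gt0.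
have I1 : (\int[lebesgue_tuple n]_(x in E)
    ((`|f x - affine T p x| / D) `^ q)%:E <= (D `^ (- q) * v)%:E)%E.
  apply: (@le_trans _ _ (\int[lebesgue_tuple n]_x ((D `^ (- q))%:E * G x))%E).
    apply: ge0_le_integral_majorant => [x|x|x Ex].
    - by rewrite lee_fin powR_ge0.
    - by rewrite mule_ge0 ?lee_fin ?(ltW Dq0).
    - rewrite powRM ?invr_ge0 ?(ltW D0) // -powR_inv1 ?(ltW D0) // -powRrM mulN1r.
      by rewrite mulrC EFinM lee_wpmul2l ?lee_fin ?(ltW Dq0) //; apply/eG/Ecell.
  rewrite ge0_integralZl_EFin ?(ltW Dq0) // EFinM.
  by rewrite lee_wpmul2l ?lee_fin ?(ltW Dq0).
have I0 : (0 <= \int[lebesgue_tuple n]_(x in E)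
    ((`|f x - affine T p x| / D) `^ q)%:E)%E.
  by apply: integral_ge0 => x _; rewrite lee_fin powR_ge0.
have Dn0 : 0 <= D ^- n by rewrite invr_ge0 exprn_ge0 // ltW.
have b0 : 0 <= beta_bound by exact: sqrtr_ge0.
have X : D ^- n * (D `^ (- q) * v) <= beta_bound `^ q.
  have dn0 : 0 < len ^- n by rewrite invr_gt0 exprn_gt0.
  have dq0 : 0 < len `^ (- q) by exact: powR_gt0.
  have m0 : 0 < m by exact: lt_le_trans m1.
  have v0 : 0 <= v by rewrite /v !mulr_ge0 ?powR_ge0 // exprn_ge0 // sizeE mulr_ge0 ?ltW.
  apply: (@le_trans _ _ (len ^- n * (len `^ (- q) * v))).
    apply: ler_pM => //; first by rewrite mulr_ge0 // ltW.
      by rewrite lef_pV2 ?posrE ?exprn_gt0 // lerXn2r ?nnegrE ?(ltW D0) ?(ltW len0).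
    rewrite ler_wpM2r // !powRN lef_pV2 ?posrE ?powR_gt0 //.
    by apply: ge0_ler_powR; rewrite ?nnegrE ?(ltW q0) ?(ltW D0) ?(ltW len0).
  rewrite /v sizeE /beta_bound -(sqr_powR q (sqrtr_ge0 _)) sqr_sqrtr; last first.
    by rewrite mulr_ge0 ?sqr_ge0 ?(ltW e0).
  have -> : ((2 * m ^+ n.+1) ^+ 2 * e) `^ (q / 2) =
      (2 * m ^+ n.+1) `^ q * e `^ (q / 2).
    by rewrite powRM ?sqr_ge0 ?(ltW e0) // sqr_powR // mulr_ge0 // exprn_ge0 // ltW.
  have -> : (e * (m * len) ^+ 2) `^ (q / 2) =
      e `^ (q / 2) * (m `^ q * len `^ q).
    rewrite powRM ?sqr_ge0 ?(ltW e0) // sqr_powR ?powRM ?(ltW m0) ?(ltW len0) //.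
    by rewrite mulr_ge0 ?(ltW m0) ?(ltW len0).
  rewrite powRN exprMn.
  have -> : (len ^+ n)^-1 * ((len `^ q)^-1 *
     (2 * (e `^ (q / 2) * (m `^ q * len `^ q) * (m ^+ n * len ^+ n)))) =
     2 * m ^+ n * m `^ q * e `^ (q / 2).
    by field; rewrite ?gt_eqF ?powR_gt0 ?exprn_gt0.
  rewrite ler_wpM2r ?powR_ge0 // [m ^+ n.+1]exprSr (mulrA 2) [leRHS]powRM ?(ltW m0) //; last first.
    by rewrite mulr_ge0 ?exprn_ge0 ?(ltW m0).
  rewrite ler_wpM2r ?powR_ge0 // le1r_powR //.
  by have := exprn_ege1 n m1; lra.
have -> : beta_bound%:E = ((beta_bound `^ q)%:E `^ q^-1)%E.
  by rewrite poweR_EFin -powRrM divff ?gt_eqF // powRr1.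
apply: gt0_ler_poweR.
- by rewrite invr_ge0 ltW.
- by rewrite in_itv /= mule_ge0 ?lee_fin //= leey.
- by rewrite in_itv /= lee_fin powR_ge0 leey.
apply: (le_trans (lee_wpmul2l _ I1)); first by rewrite lee_fin.
by rewrite -EFinM lee_fin.
Qed.

Lemma beta_infty_le :
  (forall x, cell T p x -> `|f x - affine T p x| ^+ 2 <= e * cell_size T ^+ 2) ->
  (beta_infty f E <= beta_bound%:E)%E.
Proof.
move=> H; set D := eucl_diam E; have DE : len <= D by exact: Ediam.
have D0 : 0 < D by exact: lt_le_trans DE.
have m0 : 0 < m by exact: lt_le_trans m1.
apply: ge_ereal_inf; exists (ereal_sup [set (`|f x - affine T p x| / D)%:E | x in E]).
  by exists (affine T p) => //; exact: affine_map_affine.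
apply: ge_ereal_sup => _ [x Ex <-]; rewrite lee_fin ler_pdivrMr //.
apply: (@le_trans _ _ (beta_bound * len)); last by rewrite ler_wpM2l ?sqrtr_ge0.
rewrite -ler_sqr ?nnegrE ?mulr_ge0 ?sqrtr_ge0 ?(ltW len0) //.
apply: (le_trans (H _ (Ecell Ex))); rewrite sizeE.
have M0 : 0 <= m ^+ n.+1 by rewrite exprn_ge0 // ltW.
have M1 : m <= m ^+ n.+1 by rewrite exprS ler_peMr ?(ltW m0) // exprn_ege1.
rewrite [leRHS]exprMn sqr_sqrtr; last by rewrite mulr_ge0 ?sqr_ge0 ?(ltW e0).
rewrite (_ : e * (m * len) ^+ 2 = e * len ^+ 2 * m ^+ 2); last by ring.
rewrite [leRHS](_ : _ = e * len ^+ 2 * (2 * m ^+ n.+1) ^+ 2); last by ring.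
rewrite ler_wpM2l ?mulr_ge0 ?(ltW e0) ?(ltW len0) //.
rewrite lerXn2r ?nnegrE ?(ltW m0) //; first by rewrite mulr_ge0.
by apply: (le_trans M1); rewrite ler_peMl // ler1n.
Qed.

End BetaBounds.
End BinaryTree.

(** The range of exponents in the form in which it makes the recursion for the
error contract. *)
Lemma exponent_gap (R : realType) (n' : nat) (q : R) : 0 < q ->
  ((3 <= n'.+1)%N -> (q%:E < (2 * n'.+1%:R / (n'.+1%:R - 2))%:E)%E) ->
  0 < 2 / q + 2 / n'.+1%:R - 1.
Proof.
move=> q0 H; set n := n'.+1; have n0 : 0 < n%:R :> R by rewrite ltr0n.
suff : n%:R * q < 2 * (n%:R + q).
  move=> K; rewrite (_ : _ - 1 = (2 * (n%:R + q) - n%:R * q) / (n%:R * q)); last first.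
    by field; rewrite !gt_eqF.
  by rewrite divr_gt0 ?subr_gt0 // mulr_gt0.
have [n3|] := leqP 3 n.
  have := H n3; rewrite lte_fin ltr_pdivlMr; first by rewrite -/n; lra.
  by rewrite subr_gt0 ltr_nat.
rewrite ltnS -(ler_nat R) => n2.
have := ler_wpM2r (ltW q0) n2; lra.
Qed.

(** The parameters of the recursion depend only on the dimension and on the
exponent, not on the function, the tree or the box. *)
Lemma beta_le_energy (R : realType) (n' : nat) (p : \bar R) :
  (1 <= p)%E -> (n'.+1 = 2%N -> (p < +oo)%E) ->
  ((3 <= n'.+1)%N -> (p < (2 * n'.+1%:R / (n'.+1%:R - 2))%:E)%E) ->
  exists rho K : R, [/\ 0 < rho < 1, 0 <= K &
  forall (h : R) (f : 'E[R]_n'.+1 -> R) (L : R),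
  0 < h -> 0 < L -> lipschitz_euclidean L f ->
  forall T x (E : set 'E[R]_n'.+1) (m len : R),
  1 <= m -> 0 < len -> @cell_size R n' h T = m * len ->
  E `<=` cell h T x -> len <= eucl_diam E ->
  (beta f p E <= (Num.sqrt ((2 * m ^+ n'.+2) ^+ 2 *
     error_energy h f rho K (@leaf_energy R n' L) T x))%:E)%E].
Proof.
move=> p1 p2 p3; have k1 := @kappa_gt1 R n'; have k0 := @kappa_gt0 R n'.
case: p p1 p2 p3 => [q||//] p1 p2 p3; last first.
  have n1 : n' = 0%N.
    case: n' p2 p3 {k1 k0} => [|[|n']] // p2 p3;
      [have := p2 erefl | have := p3 isT] => //.
  subst n'.
  have kE : @kappa R 0 = 2 by have := @kappaXn R 0; rewrite expr1.
  (* The values of rho and K for t = 1/2. *)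
  exists (3 / 4), 9; split; [by lra|by []|move=> h f L h0 L0 lipf T x E m len m1 d0 sE EC ED].
  have K9 : (1 + (2^-1 : R)^-1) ^+ 2 <= 9 by rewrite invrK; lra.
  have r01 : 0 < (3 / 4 : R) < 1 by lra.
  have t0 : 0 < (2^-1 : R) by [].
  apply: (@beta_infty_le _ _ _ _ T x E m len _ m1 d0 _ sE EC ED).
    apply: error_energy_gt0 => //; exact: leaf_energy_gt0.
  apply: (error_sup h0 L0 lipf t0 r01 K9).
  by rewrite kE; field.
rewrite lee_fin in p1; have q0 : 0 < q by lra.
have gap := exponent_gap q0 p3.
have [q2|q2] := leP 2 q.
  have tau01 : 0 < 2 `^ (1 - 2 / q) / @kappa R n' ^+ 2 < 1.
    have -> : @kappa R n' ^+ 2 = 2 `^ (2 / n'.+1%:R).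
      by rewrite -powR_mulrn ?(ltW k0) // -powRrM mulrC.
    rewrite divr_gt0 ?powR_gt0 //= ltr_pdivrMr ?powR_gt0 // mul1r.
    rewrite (_ : 2 / n'.+1%:R = (2 / q + 2 / n'.+1%:R - 1) + (1 - 2 / q)); last by ring.
    rewrite [ltRHS]powRD ?pnatr_eq0 ?implybT // ltr_pMl ?powR_gt0 //.
    by have := @gt0_ltr_powR R _ gap 1 2; rewrite powR1; apply; rewrite ?nnegrE // ltr1n.
  have [t t0 r01] := contraction_slack tau01; rewrite mulrA in r01.
  exists ((1 + t) ^+ 2 * 2 `^ (1 - 2 / q) / @kappa R n' ^+ 2), ((1 + t^-1) ^+ 2).
  split=> [//||h f L h0 L0 lipf T x E m len m1 d0 sE EC ED]; first exact: sqr_ge0.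
  apply: (@beta_fin_le _ _ _ _ T x E m len _ m1 d0 _ sE EC ED) => //.
    apply: error_energy_gt0; rewrite ?sqr_ge0 //; exact: leaf_energy_gt0.
  apply: majorized_le (majorized_energy h0 L0 lipf t0 r01 (lexx _) q2 erefl T x).
  rewrite ler_peMl ?mulr_ge0 ?powR_ge0 ?ler1n // exprn_ge0 //.
  exact/ltW/size_gt0.
have tau01 : 0 < @kappa R n' ^- 2 < 1.
  by rewrite invr_gt0 exprn_gt0 //= invf_lt1 ?exprn_gt0 // exprn_egt1.
have [t t0 r01] := contraction_slack tau01.
exists ((1 + t) ^+ 2 / @kappa R n' ^+ 2), ((1 + t^-1) ^+ 2).
split=> [//||h f L h0 L0 lipf T x E m len m1 d0 sE EC ED]; first exact: sqr_ge0.
apply: (@beta_fin_le _ _ _ _ T x E m len _ m1 d0 _ sE EC ED) => //.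
  apply: error_energy_gt0; rewrite ?sqr_ge0 //; exact: leaf_energy_gt0.
apply: (majorized_low h0 L0 lipf t0 r01 (lexx _) _ erefl).
by rewrite q0 ltW.
Qed.

(** * Dyadic cubes as nodes of finitely many trees *)

(** Induction on [j]: if the quotient [u] is odd, subtracting the odd modulus
makes it even, at the price of the digit [2 ^ j] in [t]. *)
Lemma odd_residue (r j : nat) (s : int) : exists (u : int) (t : nat),
  (t < 2 ^ j)%N /\ s = u * (2 ^ j)%:Z + (r.*2.+1 * t)%:Z.
Proof.
elim: j => [|j [u [t [tj ->]]]].
  by exists s, 0%N; rewrite expn0 mulr1 muln0 addr0.
have [[v ->]|[v ->]] : (exists v, u = v * 2) \/ (exists v, u = v * 2 + (r.*2.+1)%:Z).
  have uE := divz_eq u 2.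
  have : (u %% 2)%Z = 0 \/ (u %% 2)%Z = 1.
    by have := modz_ge0 u (isT : (2 : int) != 0); have := ltz_pmod u (isT : (0 : int) < 2); lia.
  by case=> uM; [left; exists (u %/ 2)%Z | right; exists ((u %/ 2)%Z - r%:Z)]; lia.
- exists v, t; split; first by rewrite expnS; lia.
  by rewrite expnS PoszM; ring.
- exists v, (t + 2 ^ j)%N; split; first by rewrite expnS; lia.
  by rewrite mulnDr expnS !PoszD !PoszM; ring.
Qed.

Section DyadicTree.
Context {R : realType} {n' : nat}.
Local Notation n := n'.+1.
Local Notation pt := 'E[R]_n.
Implicit Types (Q : dyadic n) (d i : 'I_n).

Lemma side_gt0 Q : 0 < side Q :> R.
Proof. by rewrite exprz_gt0. Qed.

Lemma dyadic_subP Q Q0 : @dcube R n Q `<=` dcube Q0 ->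
  exists j : nat, [/\ Q.1 = Q0.1 - j%:Z, side Q0 = 2 ^+ j * side Q :> R &
    forall i, tnth Q0.2 i * (2 ^ j)%:Z <= tnth Q.2 i < (tnth Q0.2 i + 1) * (2 ^ j)%:Z].
Proof.
move=> QQ0; have l0 := side_gt0 Q; have l00 := side_gt0 Q0.
set l : R := side Q in l0; set l1 : R := side Q0 in l00.
pose x : pt := [tuple (tnth Q.2 i)%:~R * l | i < n].
have xE i : coord x i = (tnth Q.2 i)%:~R * l by rewrite /coord tnth_mktuple.
have Qx : dcube Q x.
  by move=> i; rewrite -!/(coord _ _) xE lexx ltr_pM2r // ltrDl ltr01.
have Q0x i : (tnth Q0.2 i)%:~R * l1 <= (tnth Q.2 i)%:~R * l < ((tnth Q0.2 i)%:~R + 1) * l1.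
  by have := QQ0 _ Qx i; rewrite -!/(coord _ _) xE.
have kk : Q.1 <= Q0.1.
  rewrite leNgt; apply/negP => kk.
  have l1l : l1 < l by rewrite /l /l1 /side ltr_eXz2l // ltr1n.
  have Qy : dcube Q (translate ord0 l1 x).
    move=> i; rewrite -!/(coord _ _) coord_translate xE -/l.
    by case: ifP => _; apply/andP; split; lra.
  have := QQ0 _ Qy ord0; rewrite -!/(coord _ _) coord_translate xE eqxx -/l1.
  by have := Q0x ord0; lra.
have [j jE] : exists j : nat, Q0.1 - Q.1 = j%:Z.
  by exists `|Q0.1 - Q.1|%N; rewrite gez0_abs // subr_ge0.
have Q0E : Q0.1 = Q.1 + j%:Z by rewrite -jE addrC subrK.
have l1E : l1 = 2 ^+ j * l.
  by rewrite /l1 /l /side Q0E expfzDr ?pnatr_eq0 // mulrC.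
exists j; split=> // [|i]; first by rewrite Q0E addrK.
have := Q0x i; rewrite l1E !mulrA ler_pM2r // ltr_pM2r //.
rewrite -[2 ^+ j](natrX R 2 j) -[_%:R]/(((2 ^ j)%:Z)%:~R) -[1]/(1%:~R).
by rewrite -intrD -!intrM ler_int ltr_int.
Qed.

Variables (r N : nat) (Q0 : dyadic n).
Local Notation M := (r.*2.+1).

(** With this grid, the box of level [n * (N - j)] is a cube whose side is [M]
times that of the dyadic subcubes of generation [j]. *)
Definition mesh : R := M%:R * side Q0 / 2 ^+ N.

Definition gen Q : nat := `|Q0.1 - Q.1|%N.

(** Level and lower corner of the cube concentric with [Q] with [M] times its
side: this corner is [r] sides away from that of [Q], as [M = 2 * r + 1]. *)
Definition node Q : nat * pt :=
  ((n * (N - gen Q))%N, [tuple ((tnth Q.2 i)%:~R - r%:R) * side Q | i < n]).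

(** The top boxes have their corners at multiples of the side of [Q0]; the range
of [a] covers those that can contain a node. *)
Definition root_corner (a : {ffun 'I_n -> 'I_(2 * M)}) : pt :=
  [tuple ((tnth Q0.2 i)%:~R - (2 * M)%:R + (a i).+1%:R) * side Q0 | i < n].

Lemma mesh_gt0 : 0 < mesh.
Proof. by rewrite divr_gt0 ?exprn_gt0 // mulr_gt0 ?side_gt0. Qed.

Lemma genE Q (j : nat) : Q.1 = Q0.1 - j%:Z -> gen Q = j.
Proof. by rewrite /gen => ->; rewrite opprB addrC subrK. Qed.

Lemma node_side Q : @dcube R n Q `<=` dcube Q0 -> (gen Q <= N)%N ->
  forall d, cell_side mesh d (node Q).1 = M%:R * side Q.
Proof.
move=> /dyadic_subP[j [/genE jE Q0E _]] jN d; rewrite jE in jN.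
have N2 : 2 ^+ N = 2 ^+ (N - j) * 2 ^+ j :> R by rewrite -exprD subnK.
rewrite /cell_side depthMn /mesh Q0E jE N2.
by field; rewrite !expf_neq0 // pnatr_eq0.
Qed.

Lemma node_size Q : @dcube R n Q `<=` dcube Q0 -> (gen Q <= N)%N ->
  @cell_size R n' mesh (node Q).1 = M%:R * side Q.
Proof.
move=> QQ0 jN; rewrite -(node_side QQ0 jN ord0) /cell_size /cell_side depthMn.
by rewrite exprM kappaXn.
Qed.

Lemma dilate_sub_cell (C : R) Q : C <= M%:R ->
  @dcube R n Q `<=` dcube Q0 -> (gen Q <= N)%N ->
  dilate C Q `<=` cell mesh (node Q).1 (node Q).2.
Proof.
move=> CM QQ0 jN x Cx d; rewrite (node_side QQ0 jN d).
have l0 := side_gt0 Q.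
have -> : coord (node Q).2 d = ((tnth Q.2 d)%:~R - r%:R) * side Q.
  by rewrite /coord tnth_mktuple.
have := Cx d; rewrite -!/(coord _ _) /dcenter.
have := ler_wpM2r (ltW l0) CM.
have -> : M%:R = 2 * r%:R + 1 :> R by rewrite -natr1 -muln2 natrM mulrC.
move=> H /andP[lo hi]; apply/andP; split; lra.
Qed.

Lemma dilate_diam (C : R) Q : 1 <= C ->
  dilate C Q !=set0 /\ side Q / 2 <= eucl_diam (dilate C Q : set pt).
Proof.
move=> C1; have l0 := side_gt0 Q; set l : R := side Q in l0 *.
have Cl : l <= C * l by rewrite ler_peMl // ltW.
pose x : pt := [tuple dcenter Q i - C * l / 2 | i < n].
have xE i : coord x i = dcenter Q i - C * l / 2 by rewrite /coord tnth_mktuple.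
have Cx : dilate C Q x.
  by move=> i; rewrite -!/(coord _ _) xE -/l; apply/andP; split; lra.
have Cy : dilate C Q (translate ord0 (C * l / 2) x).
  move=> i; rewrite -!/(coord _ _) coord_translate xE -/l.
  by case: ifP => _; apply/andP; split; lra.
split; first by exists x.
apply: (@le_trans _ _ (eucl_dist (translate ord0 (C * l / 2) x) x)).
  by rewrite eucl_dist_translate ger0_norm; lra.
apply: sup_upper_bound; last by exists (translate ord0 (C * l / 2) x) => //; exists x.
split; first by exists (eucl_dist x x); exists x => //; exists x.
exists (n%:R * (C * l)) => _ [y Cy' [z Cz <-]]; apply: eucl_dist_le => i.
have := Cy' i; have := Cz i; rewrite -!/(coord _ _) -/l ler_norml.
move=> /andP[z1 z2] /andP[y1 y2]; apply/andP; split; lra.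
Qed.

(** In units of the side of [Q], the corner of the node is an integer and those
of the top boxes are multiples of [2 ^ j], while nodes of the same level in one
tree differ by multiples of [M]. So [odd_residue] finds the tree. *)
Lemma node_in_tree Q : @dcube R n Q `<=` dcube Q0 -> (gen Q <= N)%N ->
  exists a, in_tree mesh (n * N) (root_corner a) (node Q).
Proof.
move=> QQ0 jN; have nodeside := node_side QQ0 jN.
have [j [/genE jE Q0E Qi]] := dyadic_subP QQ0.
have H i : exists at_ : 'I_(2 * M) * nat, (at_.2 < 2 ^ j)%N /\
    tnth Q.2 i - r%:Z =
    (tnth Q0.2 i - (2 * M)%:Z + at_.1.+1%:Z) * (2 ^ j)%:Z + (M * at_.2)%:Z.
  have [u [t [tj E]]] := odd_residue r j (tnth Q.2 i - r%:Z).
  have /andP[lo hi] := Qi i.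
  have P0 : 0 < (2 ^ j)%:Z by rewrite ltz_nat expn_gt0.
  have Mt : (M * t)%:Z <= M%:Z * (2 ^ j)%:Z by rewrite -PoszM lez_nat leq_mul2l ltnW ?orbT.
  have rP : r%:Z < M%:Z * (2 ^ j)%:Z.
    rewrite -PoszM ltz_nat (@leq_trans M) //; first by rewrite -addnn; lia.
    by rewrite leq_pmulr // expn_gt0.
  have u1 : u < tnth Q0.2 i + 1.
    by rewrite -(ltr_pM2r P0); lia.
  have u2 : tnth Q0.2 i - (2 * M)%:Z < u.
    rewrite -(ltr_pM2r P0) PoszM mulrBl; nia.
  have aM : (absz (u - (tnth Q0.2 i - (2 * M)%:Z) - 1)%R < 2 * M)%N by lia.
  exists (Ordinal aM, t); split=> //=; rewrite E; congr (_ * _ + _); lia.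
have [at_ Hat] := fin_all_exists H.
exists [ffun i => (at_ i).1].
rewrite [node Q]surjective_pairing.
apply: (@in_tree_translate _ _ _ _ _ _ _ (fun i => (at_ i).2)).
- by rewrite leq_mul2l leq_subr orbT.
- move=> d; rewrite !depthMn jE subKn -?jE // jE; exact: (Hat d).1.
- move=> d; rewrite nodeside /coord !tnth_mktuple ffunE Q0E.
  have -> : (tnth Q.2 d)%:~R - r%:R = (tnth Q.2 d - r%:Z)%:~R :> R.
    by rewrite intrB.
  rewrite (Hat d).2 intrD intrM intrD intrB -[(2 ^+ j : R)]natrX.
  rewrite -!pmulrn natrM; ring.
Qed.

Lemma node_inj Q Q' : @dcube R n Q `<=` dcube Q0 -> (gen Q <= N)%N ->
  @dcube R n Q' `<=` dcube Q0 -> (gen Q' <= N)%N ->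
  node Q = node Q' -> Q = Q'.
Proof.
move=> QQ jN QQ' jN' QE; have E := congr1 snd QE.
have jj : (N - gen Q = N - gen Q')%N.
  by have /eqP := congr1 fst QE; rewrite eqn_pmul2l // => /eqP.
have [j [Qj _ _]] := dyadic_subP QQ; have [j' [Qj' _ _]] := dyadic_subP QQ'.
have gj := genE Qj; have gj' := genE Qj'.
have Q1 : Q.1 = Q'.1.
  by rewrite Qj Qj'; congr (_ - _%:Z); move: jj jN jN'; rewrite gj gj'; lia.
have l0 := side_gt0 Q'.
rewrite [Q]surjective_pairing [Q']surjective_pairing Q1; congr pair.
apply: eq_from_tnth => i.
have := congr1 (fun t : pt => coord t i) E.
rewrite /coord /= !tnth_mktuple {1}/side Q1 -/(side Q').
by move/(mulIf (lt0r_neq0 l0))/addIr/intr_inj.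
Qed.

Lemma node_vol Q : @dcube R n Q `<=` dcube Q0 -> (gen Q <= N)%N ->
  vol Q = (side Q0 / 2 ^+ N) ^+ n * 2 ^+ (node Q).1 :> R.
Proof.
move=> QQ0 jN; have [j [/genE jE Q0E _]] := dyadic_subP QQ0.
rewrite jE in jN.
have N2 : 2 ^+ N = 2 ^+ (N - j) * 2 ^+ j :> R by rewrite -exprD subnK.
rewrite /vol /node /= mulnC exprM -exprMn; congr (_ ^+ _).
rewrite Q0E jE N2.
by field; rewrite !expf_neq0 // pnatr_eq0.
Qed.

(** Every node lies in one of [(2 * M) ^ n] trees, and the top box of each has
volume comparable with that of [Q0]. *)
Lemma dyadic_packing (Z : nat -> pt -> R) (B : R) (s : seq (dyadic n)) :
  uniq s ->
  {in s, forall Q, @dcube R n Q `<=` dcube Q0 /\ (gen Q <= N)%N} ->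
  (forall T p, 0 <= Z T p) ->
  (forall T p, carleson mesh Z T p <= B) ->
  \sum_(Q <- s) vol Q * Z (node Q).1 (node Q).2 <=
  ((2 * M) ^ n)%:R * vol Q0 * B.
Proof.
move=> us sP Z0 ZB.
set w : R := (side Q0 / 2 ^+ N) ^+ n.
have w0 : 0 <= w by rewrite exprn_ge0 // divr_ge0 ?exprn_ge0 // ltW ?side_gt0.
pose F (k : nat * pt) : R := 2 ^+ k.1 * Z k.1 k.2.
have F0 k : 0 <= F k by rewrite mulr_ge0 ?exprn_ge0.
have usn : uniq [seq node Q | Q <- s].
  rewrite map_inj_in_uniq // => Q Q' /sP[Q1 Q2] /sP[Q1' Q2']; exact: node_inj.
apply: (@le_trans _ _ (w * \sum_a \sum_(k <- [seq node Q | Q <- s] |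
    in_tree mesh (n * N) (root_corner a) k) F k)).
  rewrite (exchange_big_dep xpredT) //= big_map mulr_sumr.
  rewrite big_seq [leRHS]big_seq; apply: ler_sum => Q sQ.
  have [Q1 Q2] := sP Q sQ.
  rewrite (node_vol Q1 Q2) -/w -mulrA ler_wpM2l //.
  have [a aQ] := node_in_tree Q1 Q2.
  by rewrite (bigD1 a) //= lerDl sumr_ge0.
apply: (@le_trans _ _ (w * \sum_(a : {ffun 'I_n -> 'I_(2 * M)}) 2 ^+ (n * N) * B)).
  rewrite ler_wpM2l // ler_sum // => a _.
  have := @tree_packing _ _ mesh Z _ (n * N)%N (root_corner a) usn Z0.
  by move/le_trans; apply; rewrite ler_wpM2l ?exprn_ge0.
rewrite sumr_const card_ffun !card_ord -[_ *+ _]mulr_natl.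
have -> : vol Q0 = w * 2 ^+ (n * N) :> R.
  by rewrite /vol /w mulnC exprM -exprMn divfK // expf_neq0 // pnatr_eq0.
by rewrite le_eqVlt; apply/orP; left; apply/eqP; ring.
Qed.

End DyadicTree.

Theorem theorem1p1 (R : realType) (n : nat) (p : \bar R) (C : R) :
  (1 <= n)%N ->
  (1 <= p)%E ->
  (n = 2%N -> (p < +oo)%E) ->
  ((3 <= n)%N -> (p < (2 * n%:R / (n%:R - 2))%:E)%E) ->
  1 <= C ->
  exists K : R, forall (L : R) (f : 'E[R]_n -> R),
    lipschitz_euclidean L f ->
    forall Q0 : dyadic n,
      (\esum_(Q in [set Q : dyadic n | @dcube R n Q `<=` dcube Q0])
          (beta f p (dilate C Q) ^+ 2 * (vol Q)%:E)
       <= (K * L ^+ 2 * vol Q0)%:E)%E.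
Proof.
case: n => // n' _ p1 p2 p3 C1; set n := n'.+1.
have [rho [Ke [rho01 Ke0 betaE]]] := beta_le_energy p1 p2 p3.
have /andP[rho0 rho1] := rho01.
have [r Cr] : exists r : nat, C <= r.*2.+1%:R.
  exists (Num.truncn C); apply: (le_trans (ltW (truncnS_gt C))).
  by rewrite ler_nat ltnS -addnn leq_addr.
set M := r.*2.+1 in Cr; set m : R := 2 * M%:R.
have M1 : 1 <= M%:R :> R by rewrite ler1n.
have m1 : 1 <= m by rewrite /m; lra.
set B : R := (2 * m ^+ n.+1) ^+ 2.
have B0 : 0 <= B by exact: sqr_ge0.
set c : R := ((2 * n%:R) ^+ 2 + Ke * @gap_const R n') / (1 - rho).
have gc0 : 0 <= @gap_const R n'.
  by apply: addr_ge0; apply: mulr_ge0; rewrite ?sqr_ge0 ?mulr_ge0.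
have c0 : 0 <= c.
  by rewrite divr_ge0 ?subr_ge0 ?(ltW rho1) // addr_ge0 ?sqr_ge0 // mulr_ge0.
set K : R := ((2 * M) ^ n)%:R * B * c.
have K0 : 0 <= K by exact: mulr_ge0 (mulr_ge0 (ler0n _ _) B0) c0.
have main (L : R) (f : 'E[R]_n -> R) (Q0 : dyadic n) :
    0 < L -> lipschitz_euclidean L f ->
    (\esum_(Q in [set Q : dyadic n | @dcube R n Q `<=` dcube Q0])
      (beta f p (dilate C Q) ^+ 2 * (vol Q)%:E) <= (K * L ^+ 2 * vol Q0)%:E)%E.
  move=> L0 lipf; apply: ge_ereal_sup => _ [X [finX XQ] <-].
  have [s us XE] : exists2 s : seq (dyadic n), uniq s & X = [set` s].
    have /finite_seqP[s ->] := finX; exists (undup s); first exact: undup_uniq.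
    by apply/seteqP; split=> Q /=; rewrite mem_undup.
  rewrite XE -fsbig_seq //=.
  set N := \max_(Q <- s) gen Q0 Q.
  have sP : {in s, forall Q, @dcube R n Q `<=` dcube Q0 /\ (gen Q0 Q <= N)%N}.
    move=> Q sQ; split; first by apply: XQ; rewrite XE.
    by apply: leq_bigmax_seq.
  pose nd := @node R n' r N Q0.
  set h : R := mesh r N Q0; have h0 : 0 < h by exact: mesh_gt0.
  set Z := error_energy h f rho Ke (@leaf_energy R n' L).
  have Z0 T x : 0 <= Z T x.
    by apply/ltW/error_energy_gt0 => //; exact: leaf_energy_gt0.
  have ZB T x : carleson h Z T x <= c * L ^+ 2.
    have -> : c * L ^+ 2 =
        (@leaf_energy R n' L + Ke * @gap_const R n' * L ^+ 2) / (1 - rho).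
      by rewrite /c /leaf_energy -/n; field; rewrite subr_eq0 gt_eqF.
    exact: (carleson_error h0 L0 lipf T x rho01 Ke0).
  apply: (@le_trans _ _ (\sum_(Q <- s)
      (B * (vol Q * Z (nd Q).1 (nd Q).2))%:E)%E).
    rewrite big_seq [leRHS]big_seq; apply: lee_sum => Q sQ.
    have [QQ0 jN] := sP Q sQ; have l0 : 0 < side Q :> R by exact: side_gt0.
    have [ne Dl] := @dilate_diam R n' C Q C1.
    have l20 : 0 < side Q / 2 :> R by rewrite divr_gt0.
    have sE : @cell_size R n' h (nd Q).1 = m * (side Q / 2).
      by apply: (etrans (node_size r QQ0 jN)); rewrite /m -/M; field.
    have := betaE h f L h0 L0 lipf _ _ _ _ _ m1 l20 sE (dilate_sub_cell Cr QQ0 jN) Dl.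
    rewrite -/B -/Z => bZ.
    rewrite mulrCA EFinM muleC lee_wpmul2l ?lee_fin ?exprn_ge0 ?(ltW l0) //.
    have b0 := @beta_ge0 R n' f p (dilate C Q) ne.
    apply: (@le_trans _ _ ((Num.sqrt (B * Z (nd Q).1 (nd Q).2))%:E ^+ 2)%E).
      by rewrite lee_sqr // lee_fin sqrtr_ge0.
    by rewrite -EFin_expe sqr_sqrtr // mulr_ge0.
  rewrite sumEFin lee_fin -mulr_sumr.
  have := dyadic_packing us sP Z0 ZB.
  move/(ler_wpM2l B0) => H; apply: (le_trans H).
  by rewrite le_eqVlt; apply/orP; left; apply/eqP; rewrite /K; ring.
exists K => L f lipf Q0.
have v0 : 0 <= vol Q0 :> R by rewrite exprn_ge0 // ltW // side_gt0.
have L0 : 0 <= L.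
  have := lipf (translate ord0 1 [tuple 0 | i < n]) [tuple 0 | i < n].
  by rewrite eucl_dist_translate normr1 mulr1; exact: le_trans.
have [L00|] := eqVneq L 0; last by move=> Ln0; apply: main => //; rewrite lt_def Ln0.
(* The estimates ask for a positive Lipschitz constant; if L = 0 they hold for
   every such constant, and the one below makes the bound at most e. *)
rewrite L00 expr0n /= mulr0 mul0r; apply/lee_addgt0Pr => e e0; rewrite add0e.
set a : R := K * vol Q0 + 1; have a0 : 0 < a by rewrite ltr_wpDl // (mulr_ge0 K0 v0).
have ea0 : 0 < e / a by rewrite divr_gt0.
apply: (le_trans (main (Num.sqrt (e / a)) f Q0 _ _)).
- by rewrite sqrtr_gt0.
- move=> x y; apply: (le_trans (lipf x y)); rewrite L00 mul0r.
  by rewrite mulr_ge0 ?sqrtr_ge0.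
- rewrite sqr_sqrtr ?(ltW ea0) // lee_fin mulrAC mulrA ler_pdivrMr // mulrC.
  by rewrite ler_wpM2l ?(ltW e0) // /a lerDl.
Qed.
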